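(* If $B=N\pi$ for some $N\in\mathbb N$ ($N\geq 1$), then $J_{B,1}=N$, and there do not exist any maximizers for $J_{B,1}$ in $L^2(\mathbb T)$; that is, there is no $u_0\in L^2(\mathbb T)$ with $\|u_0\|_{L^2}=1$ and $W_B(u_0)=J_{B,1}$.
   Context: $\mathbb T=\mathbb R/(2\pi\mathbb Z)$. $L^2(\mathbb T)$ is the space of complex-valued, measurable, $2\pi$-periodic functions that are square-integrable on $[0,2\pi]$, with $\|u\|_{L^2}^2=\int_{\mathbb T}|u(x)|^2\,dx$. Fourier coefficients: $\hat u(n)=\frac1{2\pi}\int_{\mathbb T}e^{-inx}u(x)\,dx$, $n\in\mathbb Z$. For $t\in\mathbb R$, $T_t:L^2(\mathbb T)\to L^2(\mathbb T)$ is defined by $\widehat{T_tu}(n)=e^{-in^2t}\hat u(n)$. For $B>0$, $W_B(u)=\int_0^B\int_{\mathbb T}|T_tu(x)|^4\,dx\,dt$, and $J_{B,1}=\sup\{W_B(u):u\in L^2(\mathbb T),\ \|u\|_{L^2}=1\}$. *)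

(* Defs.v *)
From HB Require Import structures.
From mathcomp Require Import all_boot all_order all_algebra.
From mathcomp Require Import all_classical all_reals all_analysis.
From mathcomp Require Import complex.

Set Implicit Arguments.
Unset Strict Implicit.
Unset Printing Implicit Defensive.

Import Order.TTheory GRing.Theory Num.Theory.
Import numFieldNormedType.Exports.

Local Open Scope classical_set_scope.
Local Open Scope ring_scope.
Local Open Scope complex_scope.

Section Torus.
Context {R : realType}.

Let mu := @lebesgue_measure R.

(* Functions on T = R/(2 pi Z) are 2 pi-periodic functions on R; integrals over
   T are taken over the period [0, 2 pi]. *)
Definition period : set R := `[0, 2 * pi].

Definition cmeasurable (u : R -> R[i]) : Prop :=
  measurable_fun setT (fun x => complex.Re (u x)) /\
  measurable_fun setT (fun x => complex.Im (u x)).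

Definition cintegral (D : set R) (u : R -> R[i]) : R[i] :=
  (\int[mu]_(x in D) complex.Re (u x)) +i* (\int[mu]_(x in D) complex.Im (u x)).

(* Elements of L^2(T) are handled as functions, not as classes modulo almost
   everywhere equality. *)
Definition L2T : set (R -> R[i]) := [set u |
  [/\ cmeasurable u,
      forall x, u (x + 2 * pi) = u x &
      (\int[mu]_(x in period) (Normc.normc (u x) ^+ 2)%:E < +oo)%E]].

Definition L2norm (u : R -> R[i]) : R :=
  Num.sqrt (\int[mu]_(x in period) (Normc.normc (u x) ^+ 2)).

Definition expi (theta : R) : R[i] := cos theta +i* sin theta.

Definition fourier (u : R -> R[i]) (n : int) : R[i] :=
  ((2 * pi)^-1)%:C * cintegral period (fun x => expi (- (n%:~R * x)) * u x).

(* T_t u, as a chosen representative.  For u in L^2(T) a function v as below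
   exists (Riesz-Fischer) and is unique up to almost everywhere equality, so
   that the value 0 is not used and integrals of T_t u over a period do not
   depend on the choice. *)
Definition schrodinger (t : R) (u : R -> R[i]) : R -> R[i] :=
  xget (fun=> 0) [set v | L2T v /\
    forall n : int, fourier v n = expi (- (n%:~R ^+ 2 * t)) * fourier u n].

Definition W (B : R) (u : R -> R[i]) : \bar R :=
  (\int[mu]_(t in `[0%R, B]) \int[mu]_(x in period)
     (Normc.normc (schrodinger t u x) ^+ 4)%:E)%E.

Definition J1 (B : R) : \bar R :=
  ereal_sup [set W B u | u in [set u | L2T u /\ L2norm u = 1]].

End Torus.

(* Main.v *)
(** Write [a_n] for the Fourier coefficients of [u].  For a trigonometric
    polynomial [|T_t u|^4] expands into exponentials [e^(i (s x - e t))] with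
    [s = k1 + k2 - k3 - k4] and [e = k1^2 + k2^2 - k3^2 - k4^2].  Integration in
    [x] leaves [s = 0]; then [e] is even, so integration over [0, N pi] leaves
    [e = 0].  Both vanish only if [{k1, k2} = {k3, k4}], whence
    [W = 2 pi^2 N (2 (sum |a_n|^2)^2 - sum |a_n|^4)].  Since [sum |a_n|^2] is
    [1 / (2 pi)], this is [N (1 - 2 pi^2 sum |a_n|^4) < N], and [K] equal
    coefficients give [N (1 - 1 / (2 K))].
    For general [u] only the upper bound is needed, and it follows from Fatou's
    lemma along partial Fourier sums converging almost everywhere to [T_t u]; as
    [|a_n|] is preserved by the flow, one subsequence serves all [t].  The limit
    is identified by uniqueness of Fourier coefficients of L^1 functions, so
    that neither Riesz-Fischer nor Parseval is used. *)

Require Import Defs.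
From HB Require Import structures.
From mathcomp Require Import all_boot all_order all_algebra.
From mathcomp Require Import all_classical all_reals all_analysis.
From mathcomp Require Import measurable_realfun complex ring lra.

Set Implicit Arguments.
Unset Strict Implicit.
Unset Printing Implicit Defensive.

Import Order.TTheory GRing.Theory Num.Theory.
Import numFieldNormedType.Exports.

Local Open Scope classical_set_scope.
Local Open Scope ring_scope.
Local Open Scope complex_scope.

(** Strictness has to survive a limit that only yields inequalities. So an index [m] is fixed first
    and every partial sum is taken long enough to contain it. The loss [2 pi^2 |a_m|^4] is then
    present before Fatou's lemma is applied, and [W <= N (1 - 2 pi^2 |a_m|^4)]. Some [a_m] is
    nonzero, because a function whose coefficients all vanish is 0 almost everywhere and cannot have
    norm 1. Bessel's inequality bounds the mass by [1 / (2 pi)], the direction that the estimate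
    calls for.

    Almost everywhere convergence comes from thinning the partial sums: if the block between [K j]
    and [K (j+1)] carries at most [4^-j] of the sum of the [|a_n|^2], the increments have L^1 norm
    of order [2^-j]. Their sum is an integrable majorant, under which each Fourier coefficient
    passes to the limit.

    Uniqueness for L^1 functions rests on Lebesgue differentiation. It suffices that integrals over
    small balls vanish, and the indicator of a ball is a bounded limit of polynomials in
    [cos (x - c)]. *)

Lemma measurable_period {R : realType} : measurable (@period R).
Proof. exact: measurable_itv. Qed.

#[local] Hint Extern 0 (measurable _) =>
  solve [exact: measurable_period] : core.

(** * Complex arithmetic and the exponential [expi] *)

Section complex_arith.
Context {R : realType}.
Implicit Types (z w : R[i]) (a b : R).
Local Notation Re := complex.Re.
Local Notation Im := complex.Im.

Lemma cReD z w : Re (z + w) = Re z + Re w.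
Proof. by case: z; case: w. Qed.

Lemma cImD z w : Im (z + w) = Im z + Im w.
Proof. by case: z; case: w. Qed.

Lemma cReB z w : Re (z - w) = Re z - Re w.
Proof. by case: z; case: w. Qed.

Lemma cImB z w : Im (z - w) = Im z - Im w.
Proof. by case: z; case: w. Qed.

Lemma cReM z w : Re (z * w) = Re z * Re w - Im z * Im w.
Proof. by case: z; case: w. Qed.

Lemma cImM z w : Im (z * w) = Re z * Im w + Im z * Re w.
Proof. by case: z; case: w. Qed.

Lemma complex_ext z w : Re z = Re w -> Im z = Im w -> z = w.
Proof. by case: z => ? ?; case: w => ? ? /= -> ->. Qed.

Lemma realcM (x y : R) : (x * y)%:C = x%:C * y%:C.
Proof. exact: rmorphM. Qed.

Lemma realcB (x y : R) : (x - y)%:C = x%:C - y%:C.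
Proof. exact: rmorphB. Qed.

Lemma realc_sum I (r : seq I) (P : pred I) (F : I -> R) :
  (\sum_(i <- r | P i) F i)%:C = \sum_(i <- r | P i) (F i)%:C.
Proof. exact: rmorph_sum. Qed.

Lemma conjcM (z w : R[i]) : conjc (z * w) = conjc z * conjc w.
Proof. exact: rmorphM. Qed.

Lemma conjc_sum I (r : seq I) (P : pred I) (F : I -> R[i]) :
  conjc (\sum_(i <- r | P i) F i) = \sum_(i <- r | P i) conjc (F i).
Proof. exact: rmorph_sum. Qed.

Lemma normc_ge0 z : 0 <= Normc.normc z.
Proof. by case: z => ? ? /=; exact: sqrtr_ge0. Qed.

Lemma normc_sqr z : Normc.normc z ^+ 2 = Re z ^+ 2 + Im z ^+ 2.
Proof. by case: z => x y /=; rewrite sqr_sqrtr// addr_ge0// sqr_ge0. Qed.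

Lemma normc_sqrC z : (Normc.normc z ^+ 2)%:C = z * conjc z.
Proof.
rewrite normc_sqr; case: z => x y; apply: complex_ext => /=; ring.
Qed.

Lemma normc_Re z : `|Re z| <= Normc.normc z.
Proof.
rewrite -ler_sqr ?nnegrE ?normr_ge0 ?normc_ge0//.
by rewrite normc_sqr real_normK ?num_real// lerDl sqr_ge0.
Qed.

Lemma normc_Im z : `|Im z| <= Normc.normc z.
Proof.
rewrite -ler_sqr ?nnegrE ?normr_ge0 ?normc_ge0//.
by rewrite normc_sqr real_normK ?num_real// lerDr sqr_ge0.
Qed.

Lemma expi0 : expi 0 = 1 :> R[i].
Proof. by apply: complex_ext; rewrite /= ?cos0 ?sin0. Qed.

Lemma expiD a b : expi (a + b) = expi a * expi b :> R[i].
Proof. by apply: complex_ext; rewrite /= ?cosD ?sinD//; ring. Qed.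

Lemma conjc_expi a : conjc (expi a) = expi (- a) :> R[i].
Proof. by rewrite /expi cosN sinN. Qed.

Lemma expi_mulN a : expi a * expi (- a) = 1 :> R[i].
Proof. by rewrite -expiD subrr expi0. Qed.

Lemma normc_expi a : Normc.normc (expi a) = 1 :> R.
Proof. by rewrite /= cos2Dsin2 sqrtr1. Qed.

Lemma expi_pi_mul2 (m : int) : expi (m%:~R * (2 * pi)) = 1 :> R[i].
Proof.
have h (k : nat) : expi (k%:R * (2 * pi)) = 1 :> R[i].
  elim: k => [|k IH]; first by rewrite mul0r expi0.
  rewrite -addn1 natrD mulrDl expiD IH !mul1r.
  by rewrite mulrC mulr_natr /expi cos2pi sin2pi.
case: m => k; first exact: h.
rewrite NegzE mulrNz mulNr -[RHS](expi_mulN (k.+1%:R * (2 * pi))).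
by rewrite -pmulrn h mul1r.
Qed.

End complex_arith.

(** * Continuity and integrals of complex functions, by real and imaginary parts *)

Section complex_integral.
Context {R : realType}.
Let mu := @lebesgue_measure R.
Implicit Types (D : set R) (f g : R -> R[i]).
Local Notation Re := complex.Re.
Local Notation Im := complex.Im.

Definition cintegrable D f :=
  mu.-integrable D (fun x => (Re (f x))%:E) /\
  mu.-integrable D (fun x => (Im (f x))%:E).

Definition ccontinuous f :=
  continuous (fun x => Re (f x)) /\ continuous (fun x => Im (f x)).

Lemma ccontinuousM f g : ccontinuous f -> ccontinuous g ->
  ccontinuous (fun x => f x * g x).
Proof.
move=> [fr fi] [gr gi]; split => x; under eq_fun do rewrite ?cReM ?cImM.
  by apply: cvgB; apply: cvgM; [exact: fr|exact: gr|exact: fi|exact: gi].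
by apply: cvgD; apply: cvgM; [exact: fr|exact: gi|exact: fi|exact: gr].
Qed.

Lemma ccontinuousD f g : ccontinuous f -> ccontinuous g ->
  ccontinuous (fun x => f x + g x).
Proof.
move=> [fr fi] [gr gi]; split => x; under eq_fun do rewrite ?cReD ?cImD.
  by apply: cvgD; [exact: fr|exact: gr].
by apply: cvgD; [exact: fi|exact: gi].
Qed.

Lemma ccontinuous_conj f : ccontinuous f -> ccontinuous (fun x => conjc (f x)).
Proof.
move=> [fr fi]; split => x.
  rewrite (_ : (fun x => _) = (fun x => Re (f x))); first exact: fr.
  by apply/funext => y; case: (f y).
rewrite (_ : (fun x => _) = (fun x => - Im (f x))); last first.
  by apply/funext => y; case: (f y).
by apply: cvgN; exact: fi.
Qed.

Lemma ccontinuous_cst z : ccontinuous (fun=> z).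
Proof. by split => x; exact: cvg_cst. Qed.

Lemma ccontinuous_sum I (s : seq I) (F : I -> R -> R[i]) :
  (forall i, ccontinuous (F i)) -> ccontinuous (fun x => \sum_(i <- s) F i x).
Proof.
move=> cF; elim: s => [|i s IH].
  by under eq_fun do rewrite big_nil; exact: ccontinuous_cst.
by under eq_fun do rewrite big_cons; exact: ccontinuousD.
Qed.

Lemma ccontinuous_expi (a : R) : ccontinuous (fun x => expi (a * x)).
Proof.
have ca : continuous (fun x : R => a * x).
  by move=> x; apply: cvgM; [exact: cvg_cst|exact: cvg_id].
split => x /=.
  by apply: (@continuous_comp _ _ _ (fun x => a * x) cos);
    [exact: ca|exact: continuous_cos].
by apply: (@continuous_comp _ _ _ (fun x => a * x) sin);
  [exact: ca|exact: continuous_sin].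
Qed.

Lemma continuous_integrable (a b : R) (f : R -> R) : continuous f ->
  mu.-integrable `[a, b] (EFin \o f).
Proof.
move=> cf; apply: continuous_compact_integrable; first exact: segment_compact.
exact: continuous_subspaceT.
Qed.

Lemma ccontinuous_integrable (a b : R) f : ccontinuous f ->
  cintegrable `[a, b] f.
Proof. by move=> [fr fi]; split; exact: continuous_integrable. Qed.

Section fixed_domain.
Context (D : set R) (mD : measurable D).

Lemma cintegrableD f g : cintegrable D f -> cintegrable D g ->
  cintegrable D (fun x => f x + g x).
Proof.
move=> [fr fi] [gr gi]; split; under eq_fun do rewrite ?cReD ?cImD EFinD;
  exact: integrableD.
Qed.

Lemma cintegralD f g : cintegrable D f -> cintegrable D g ->
  cintegral D (fun x => f x + g x) = cintegral D f + cintegral D g.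
Proof.
move=> [fr fi] [gr gi]; apply: complex_ext; rewrite ?cReD ?cImD /=.
  by rewrite -RintegralD//; apply: eq_Rintegral => x _; rewrite cReD.
by rewrite -RintegralD//; apply: eq_Rintegral => x _; rewrite cImD.
Qed.

Lemma cintegrableZ (z : R[i]) f : cintegrable D f ->
  cintegrable D (fun x => z * f x).
Proof.
move=> [fr fi]; split; under eq_fun do rewrite ?cReM ?cImM.
  under eq_fun do rewrite EFinB !EFinM.
  by apply: integrableB => //; exact: integrableZl.
under eq_fun do rewrite EFinD !EFinM.
by apply: integrableD => //; exact: integrableZl.
Qed.

Lemma cintegralZ (z : R[i]) f : cintegrable D f ->
  cintegral D (fun x => z * f x) = z * cintegral D f.
Proof.
move=> [fr fi].
have iZ (a : R) (h : R -> R) : mu.-integrable D (fun x => (h x)%:E) ->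
    mu.-integrable D (EFin \o (fun x => a * h x)).
  by move=> ih; rewrite /comp; under eq_fun do rewrite EFinM; exact: integrableZl.
apply: complex_ext; rewrite ?cReM ?cImM /=.
  rewrite -!RintegralZl// -RintegralB//; try exact: iZ.
  by apply: eq_Rintegral => x _; rewrite cReM.
rewrite -!RintegralZl// -RintegralD//; try exact: iZ.
by apply: eq_Rintegral => x _; rewrite cImM.
Qed.

Lemma cintegrable0 : cintegrable D (fun=> 0).
Proof. by split => /=; exact: integrable0. Qed.

Lemma cintegral0 : cintegral D (fun=> 0) = 0.
Proof. by apply: complex_ext; rewrite /= Rintegral_cst// mul0r. Qed.

Lemma cintegrable_sum I (s : seq I) (F : I -> R -> R[i]) :
  (forall i, cintegrable D (F i)) ->
  cintegrable D (fun x => \sum_(i <- s) F i x).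
Proof.
move=> iF; elim: s => [|i s IH].
  by under eq_fun do rewrite big_nil; exact: cintegrable0.
by under eq_fun do rewrite big_cons; exact: cintegrableD.
Qed.

Lemma cintegral_sum I (s : seq I) (F : I -> R -> R[i]) :
  (forall i, cintegrable D (F i)) ->
  cintegral D (fun x => \sum_(i <- s) F i x) = \sum_(i <- s) cintegral D (F i).
Proof.
move=> iF; elim: s => [|i s IH].
  by under eq_fun do rewrite big_nil; rewrite big_nil cintegral0.
under eq_fun do rewrite big_cons.
by rewrite big_cons cintegralD// ?IH//; exact: cintegrable_sum.
Qed.

End fixed_domain.

(** The antiderivatives [sin (a x) / a] and [- cos (a x) / a] agree at [0] and [b]. The length [b]
    is left free because it serves both [2 pi] in space and [N pi] in time. *)
Lemma cintegral_expi (a b : R) : 0 < b -> expi (a * b) = 1 ->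
  cintegral `[0, b] (fun x => expi (a * x)) = (if a == 0 then b else 0)%:C.
Proof.
move=> b0 ab1; have [->|a0] := eqVneq a 0.
  rewrite (_ : (fun x : R => expi (0 * x)) = fun=> 1); last first.
    by apply/funext => x; rewrite mul0r expi0.
  apply: complex_ext; rewrite /= Rintegral_cst//= lebesgue_measure_itv/= lte_fin b0.
    by rewrite mul1r/= subr0.
  by rewrite mul0r.
have [cab sab] : cos (a * b) = 1 /\ sin (a * b) = 0 by move: ab1 => -[].
have dl (x : R) : is_derive x 1 (fun x : R => a * x) a.
  by apply: is_derive_eq; rewrite /GRing.scale /= mulr1.
have [ce si] := ccontinuous_expi a.
have ftc (f F : R -> R) : continuous f -> continuous F ->
    (forall x : R, is_derive x 1 F (f x)) -> \int[mu]_(x in `[0, b]) f x = F b - F 0.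
  move=> cf cF dF; rewrite /Rintegral (continuous_FTC2 (F := F) b0) -?EFinB//.
  - exact: continuous_subspaceT.
  - split.
    + by move=> x _; exact: ex_derive.
    + by apply: cvg_at_right_filter; exact: cF.
    + by apply: cvg_at_left_filter; exact: cF.
  - by move=> x _; rewrite derive1E derive_val.
have dsin (x : R) : is_derive x 1 (fun x : R => a^-1 * sin (a * x)) (cos (a * x)).
  have h := @is_derive1_comp _ sin (fun x => a * x) x _ _ (is_derive_sin (a * x)) (dl x).
  by apply: is_derive_eq; rewrite /GRing.scale /=; field.
have dcos (x : R) : is_derive x 1 (fun x : R => - a^-1 * cos (a * x)) (sin (a * x)).
  have h := @is_derive1_comp _ cos (fun x => a * x) x _ _ (is_derive_cos (a * x)) (dl x).
  by apply: is_derive_eq; rewrite /GRing.scale /=; field.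
apply: complex_ext => /=.
  rewrite (ftc _ _ _ _ dsin) ?sab ?mulr0 ?sin0 ?mulr0 ?subrr//.
  by move=> x; apply: cvgM; [exact: cvg_cst|exact: si].
rewrite (ftc _ _ _ _ dcos) ?cab ?mulr0 ?cos0 ?mulr0 ?subrr//.
by move=> x; apply: cvgM; [exact: cvg_cst|exact: ce].
Qed.

End complex_integral.


(** * Uniqueness of Fourier coefficients *)

Section bernoulli_step.
Context {R : realType}.
Implicit Types (q t y : R).

Lemma bernoulli_le y m : 0 <= y <= 1 -> 1 - m%:R * y <= (1 - y) ^+ m.
Proof.
move=> /andP[y0 y1]; elim: m => [|m IH]; first by rewrite mul0r subr0 expr0.
rewrite exprS -natr1; apply: (@le_trans _ _ ((1 - y) * (1 - m%:R * y))).
  have : 0 <= m%:R * y ^+ 2 by rewrite mulr_ge0// sqr_ge0.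
  by rewrite expr2; nra.
by rewrite ler_wpM2l// subr_ge0.
Qed.

(** Induction works because [(1 - y) (1 + (m + 1) y) <= 1 + m y]. *)
Lemma bernoulli_ge y m : 0 <= y <= 1 -> (1 - y) ^+ m * (1 + m%:R * y) <= 1.
Proof.
move=> /andP[y0 y1]; elim: m => [|m IH]; first by rewrite mul0r addr0 mulr1 expr0.
rewrite exprS -natr1; apply: le_trans IH.
rewrite [_ * _ ^+ m]mulrC -mulrA ler_wpM2l ?exprn_ge0 ?subr_ge0//.
have m0 : 0 <= m%:R :> R by [].
have : 0 <= m%:R * y ^+ 2 by rewrite mulr_ge0// sqr_ge0.
by rewrite expr2; nra.
Qed.

(* By Bernoulli's inequality [(1 - q^n)^m] with [m ~ t^-n] tends to the indicator
   of [q < t], boundedly. *)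
Definition step_exponent t n := Num.truncn (t ^- n).

(** Rounding down gives [m <= t^-n], so the power is at least [1 - m q^n >= 1 - (q / t)^n]. *)
Lemma cvg_step_lt q t : 0 < t -> 0 <= q < t -> q <= 1 ->
  (1 - q ^+ n) ^+ step_exponent t n @[n --> \oo] --> (1 : R).
Proof.
move=> t0 /andP[q0 qt] q1.
have h0 : (q / t) ^+ n @[n --> \oo] --> (0 : R).
  apply: cvg_expr; rewrite ger0_norm ?divr_ge0 ?(ltW t0)//.
  by rewrite ltr_pdivrMr// mul1r.
have h1 : 1 - (q / t) ^+ n @[n --> \oo] --> (1 : R).
  by rewrite -[X in _ --> X]subr0; apply: cvgB => //; exact: cvg_cst.
apply: (squeeze_cvgr _ h1 (@cvg_cst _ (1 : R) _ _ _)).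
apply: nearW => n; have qn : 0 <= q ^+ n <= 1.
  by apply/andP; split; [exact: exprn_ge0|exact: exprn_ile1].
apply/andP; split; last first.
  by case/andP: qn => a b; apply: exprn_ile1; [rewrite subr_ge0|rewrite gerBl].
apply: le_trans (bernoulli_le _ qn); rewrite lerB// expr_div_n mulrC.
case/andP: qn => a _; apply: ler_wpM2l => //.
have : 0 <= t ^- n by rewrite invr_ge0 exprn_ge0// ltW.
by move=> /truncn_itv /andP[].
Qed.

Lemma cvg_step_gt q t : 0 < t -> t < q -> q <= 1 ->
  (1 - q ^+ n) ^+ step_exponent t n @[n --> \oo] --> (0 : R).
Proof.
move=> t0 tq q1; have q0 := lt_trans t0 tq.
have h0 : (t / q) ^+ n @[n --> \oo] --> (0 : R).
  apply: cvg_expr; rewrite ger0_norm ?divr_ge0 ?(ltW t0) ?(ltW q0)//.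
  by rewrite ltr_pdivrMr// mul1r.
apply: (squeeze_cvgr _ (@cvg_cst _ (0 : R) _ _ _) h0).
apply: nearW => n.
have qn : 0 <= q ^+ n <= 1.
  by apply/andP; split; [apply: exprn_ge0; exact: ltW|apply: exprn_ile1 => //; exact: ltW].
have p0 : 0 <= (1 - q ^+ n) ^+ step_exponent t n.
  by rewrite exprn_ge0// subr_ge0; case/andP: qn.
rewrite p0 /=.
have := bernoulli_ge (step_exponent t n) qn.
have tn : 0 <= t ^- n by rewrite invr_ge0 exprn_ge0// ltW.
have /truncn_itv/andP[_] := tn; rewrite -/(step_exponent t n) -natr1 => ht hb.
have qn0 : 0 < q ^+ n by rewrite exprn_gt0.
(* Rounding down leaves only [t^-n < m + 1]; the missing [q^n] is absorbed by the summand [1], as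
   [q <= 1]. With [bernoulli_ge] the power is then at most [(t / q)^n]. *)
have hq : (q / t) ^+ n <= 1 + (step_exponent t n)%:R * q ^+ n.
  have : t ^- n * q ^+ n <= ((step_exponent t n)%:R + 1) * q ^+ n.
    by rewrite ler_wpM2r// ltW.
  rewrite expr_div_n mulrC mulrDl mul1r => h; apply: (le_trans h).
  by rewrite addrC lerD2r; case/andP: qn.
have -> : (t / q) ^+ n = ((q / t) ^+ n)^-1 by rewrite -exprVn invf_div.
rewrite -[leRHS]mul1r ler_pdivlMr ?exprn_gt0 ?divr_gt0//.
by apply: le_trans hb; rewrite ler_wpM2l.
Qed.

End bernoulli_step.

(** * Trigonometric polynomials and orthogonality *)

Section trigonometric_polynomials.
Context {R : realType}.
Let mu := @lebesgue_measure R.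
Implicit Types (f g : R -> R[i]) (s : seq (R[i] * int)).
Local Notation Re := complex.Re.
Local Notation Im := complex.Im.

(** Frequencies may repeat in the list, so a sum is a concatenation and a product is a list of all
    pairs, with no terms to collect. *)
Definition trigpoly f := exists s,
  forall x, f x = \sum_(p <- s) p.1 * expi (p.2%:~R * x).

Lemma trigpoly_expi (z : R[i]) (n : int) :
  trigpoly (fun x => z * expi (n%:~R * x)).
Proof. by exists [:: (z, n)] => x; rewrite big_seq1. Qed.

Lemma trigpoly_cst (z : R[i]) : trigpoly (fun=> z).
Proof. by exists [:: (z, 0)] => x; rewrite big_seq1/= mul0r expi0 mulr1. Qed.

Lemma trigpolyD f g : trigpoly f -> trigpoly g -> trigpoly (fun x => f x + g x).
Proof.
by move=> [s fs] [r gr]; exists (s ++ r) => x; rewrite big_cat/= fs gr.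
Qed.

Lemma trigpolyM f g : trigpoly f -> trigpoly g -> trigpoly (fun x => f x * g x).
Proof.
move=> [s fs] [r gr].
exists [seq (p.1 * q.1, p.2 + q.2) | p <- s, q <- r] => x.
rewrite fs gr big_allpairs_dep/= mulr_suml; apply: eq_bigr => p _.
rewrite mulr_sumr; apply: eq_bigr => q _ /=.
by rewrite intrD mulrDl expiD mulrACA.
Qed.

Lemma trigpolyX f m : trigpoly f -> trigpoly (fun x => f x ^+ m).
Proof.
move=> tf; elim: m => [|m IH]; first exact: trigpoly_cst.
by under eq_fun do rewrite exprS; exact: trigpolyM.
Qed.

Lemma trigpoly_cosB (c : R) : trigpoly (fun x => (cos (x - c))%:C).
Proof.
have [s hs] := trigpolyD (trigpoly_expi ((2^-1 : R)%:C * expi (- c)) 1)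
                         (trigpoly_expi ((2^-1 : R)%:C * expi c) (-1)).
exists s => x; rewrite -hs mulrN1z mulN1r mul1r -!mulrA -!expiD.
apply: complex_ext; rewrite ?cReD ?cImD ?cReM ?cImM /= !cosD !sinD !cosN !sinN; lra.
Qed.

Lemma ccontinuous_trigpoly f : trigpoly f -> ccontinuous f.
Proof.
move=> [s fs]; rewrite (_ : f = fun x => \sum_(p <- s) p.1 * expi (p.2%:~R * x)).
  apply: ccontinuous_sum => p; apply: ccontinuousM; first exact: ccontinuous_cst.
  exact: ccontinuous_expi.
exact/funext.
Qed.

Lemma integrable_continuousM (a b : R) (h g : R -> R) : continuous h ->
  mu.-integrable `[a, b] (fun x => (g x)%:E) ->
  mu.-integrable `[a, b] (fun x => (h x * g x)%:E).
Proof.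
move=> ch ig; apply: (@integrableMr _ _ _ mu _ _ h (fun x => (g x)%:E)) => //.
  by apply: measurable_funTS; exact: continuous_measurable_fun.
have /compact_bounded[M [_ mrt]] := @continuous_compact _ _ h `[a, b]
  (continuous_subspaceT ch) (@segment_compact _ a b).
exists M; split; rewrite ?num_real // => y yM x xab.
by apply: (mrt _ yM); exists x.
Qed.

Lemma cintegrableMl (a b : R) f v : ccontinuous f -> cintegrable `[a, b] v ->
  cintegrable `[a, b] (fun x => f x * v x).
Proof.
move=> [fr fi] [vr vi]; split.
  rewrite (_ : (fun x => (Re (f x * v x))%:E) =
      fun x => ((Re (f x) * Re (v x))%:E - (Im (f x) * Im (v x))%:E)%E).
    by apply: integrableB => //; exact: integrable_continuousM.
  by apply/funext => x; rewrite cReM EFinB.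
rewrite (_ : (fun x => (Im (f x * v x))%:E) =
    fun x => ((Re (f x) * Im (v x))%:E + (Im (f x) * Re (v x))%:E)%E).
  by apply: integrableD => //; exact: integrable_continuousM.
by apply/funext => x; rewrite cImM EFinD.
Qed.

Lemma trigpoly_orthogonal v f : cintegrable period v ->
  (forall n, fourier v n = 0) -> trigpoly f ->
  cintegral period (fun x => f x * v x) = 0.
Proof.
move=> iv v0 [s fs].
have ie (n : int) : cintegrable period (fun x => expi (n%:~R * x) * v x).
  by apply: cintegrableMl => //; exact: ccontinuous_expi.
transitivity (cintegral period (fun x => \sum_(p <- s) (p.1 * (expi (p.2%:~R * x) * v x)))).
  congr cintegral; apply/funext => x; rewrite fs mulr_suml.
  by apply: eq_bigr => p _; rewrite mulrA.
rewrite cintegral_sum//; last by move=> p; apply: cintegrableZ.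
rewrite big1// => p _; rewrite cintegralZ//.
(* The pairing has no conjugate, so the frequency [p.2] meets the coefficient of index [- p.2]. *)
have := v0 (- p.2); rewrite /fourier => /eqP; rewrite mulf_eq0 => /orP[|/eqP].
  rewrite eq_complex /= eqxx andbT invr_eq0 mulf_eq0 pnatr_eq0/= => /eqP pi0.
  by have := pi_gt0 R; rewrite pi0 ltxx.
under eq_fun do rewrite intrN mulNr opprK.
by move=> ->; rewrite mulr0.
Qed.

End trigonometric_polynomials.


(** * From orthogonality to vanishing almost everywhere *)

Section fourier_uniqueness.
Context {R : realType}.
Let mu := @lebesgue_measure R.
Local Notation Re := complex.Re.
Local Notation Im := complex.Im.

Definition rtrigpoly (p : R -> R) := trigpoly (fun x => (p x)%:C).

Lemma rtrigpolyD (p q : R -> R) : rtrigpoly p -> rtrigpoly q ->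
  rtrigpoly (fun x => p x + q x).
Proof.
by move=> tp tq; have [s hs] := trigpolyD tp tq; exists s => x; rewrite -hs rmorphD.
Qed.

Lemma rtrigpolyM (p q : R -> R) : rtrigpoly p -> rtrigpoly q ->
  rtrigpoly (fun x => p x * q x).
Proof.
by move=> tp tq; have [s hs] := trigpolyM tp tq; exists s => x; rewrite -hs rmorphM.
Qed.

Lemma rtrigpolyX (p : R -> R) m : rtrigpoly p -> rtrigpoly (fun x => p x ^+ m).
Proof.
by move=> tp; have [s hs] := trigpolyX m tp; exists s => x; rewrite -hs rmorphXn.
Qed.

Lemma cos_sub_lt (c d x : R) : 0 < d -> d < c -> c + d < 2 * pi ->
  0 <= x <= 2 * pi -> d < `|x - c| -> cos (x - c) < cos d.
Proof.
move=> d0 dc cd /andP[x0 x2] dxc; rewrite -cos_norm.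
have dpi : d <= pi by nra.
have [h|h] := leP `|x - c| pi.
  by rewrite ltr_cos// ?in_itv/= ?normr_ge0 ?h ?dpi ?(ltW d0).
(* Beyond [pi] the cosine increases again. Reflection in [pi] brings the angle back to where it
   decreases, and the ball lying inside the period keeps the reflected angle above [d]. *)
have -> : cos `|x - c| = cos (2 * pi - `|x - c|).
  by rewrite [2 * pi]mulrC mulr_natr cosB cos2pi sin2pi mul1r mul0r addr0.
have e : `|x - c| < 2 * pi - d by rewrite ltr_norml; apply/andP; split; lra.
by rewrite ltr_cos ?in_itv/=; [lra|apply/andP; split; lra|apply/andP; split; lra].
Qed.

Lemma cos_sub_gt (c d x : R) : d <= pi -> `|x - c| < d -> cos d < cos (x - c).
Proof.
move=> dpi xcd; rewrite -(cos_norm (x - c)).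
have d0 : 0 < d by apply: le_lt_trans xcd.
by rewrite ltr_cos// ?in_itv/= ?normr_ge0 ?dpi ?(ltW d0)//= (ltW (lt_le_trans xcd dpi)).
Qed.

Lemma ae_neq (a : R) : {ae mu, forall x, x != a}.
Proof.
exists [set a]; split => //; first exact: lebesgue_measure_set1.
by move=> x /= /negP; rewrite negbK => /eqP.
Qed.

(* With [q = (1 - cos (x - c)) / 2] and [t = (1 - cos d) / 2], the indicator of
   the ball is a bounded pointwise limit of trigonometric polynomials. *)
Lemma integral_ball_eq0 (w : R -> R) (c d : R) :
  mu.-integrable period (EFin \o w) ->
  (forall p : R -> R, rtrigpoly p ->
    \int[mu]_(x in period) (p x * w x) = 0) ->
  0 < d -> d < c -> c + d < 2 * pi ->
  (\int[mu]_(x in ball c d) (w x)%:E)%E = 0%E.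
Proof.
move=> iw worth d0 dc cd.
have dpi : d < pi by nra.
pose q x := (1 - cos (x - c)) / 2.
pose t := (1 - cos d) / 2.
have t0 : 0 < t.
  rewrite divr_gt0// subr_gt0 -(@cos0 R) ltr_cos// in_itv/=.
    by rewrite lexx pi_ge0.
  by rewrite (ltW d0) (ltW dpi).
have q01 x : 0 <= q x <= 1.
  have := cos_le1 (x - c); have := cos_geN1 (x - c).
  by rewrite /q => *; apply/andP; split; lra.
pose p n x := (1 - q x ^+ n) ^+ step_exponent t n.
have tq : rtrigpoly q.
  apply: rtrigpolyM; last exact: trigpoly_cst.
  apply: rtrigpolyD; first exact: trigpoly_cst.
  rewrite (_ : (fun x => - cos (x - c)) = fun x => -1 * cos (x - c)).
    by apply: rtrigpolyM; [exact: trigpoly_cst|exact: trigpoly_cosB].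
  by apply/funext => x; rewrite mulN1r.
have tp n : rtrigpoly (p n).
  apply: rtrigpolyX; apply: rtrigpolyD; first exact: trigpoly_cst.
  rewrite (_ : (fun x => - q x ^+ n) = fun x => -1 * q x ^+ n).
    by apply: rtrigpolyM; [exact: trigpoly_cst|exact: rtrigpolyX].
  by apply/funext => x; rewrite mulN1r.
have cp n : continuous (p n) by have [] := ccontinuous_trigpoly (tp n).
have p01 n x : 0 <= p n x <= 1.
  have /andP[q0 q1] := q01 x.
  have a0 := exprn_ge0 n q0; have a1 := exprn_ile1 n q0 q1.
  apply/andP; split; first by apply: exprn_ge0; rewrite subr_ge0.
  by apply: exprn_ile1; rewrite ?subr_ge0// gerBl.
have ipw n : mu.-integrable period (fun x => (p n x * w x)%:E).
  exact: integrable_continuousM.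
have mw : measurable_fun period w.
  by apply/measurable_EFinP; exact: measurable_int iw.
have mb : measurable (ball c d) by exact: measurable_ball.
pose f x := ((w \_ (ball c d)) x)%:E.
have mf : measurable_fun period f.
  apply/measurable_EFinP; apply: (@measurable_funS _ _ _ _ setT) => //.
  (* Measurability of [w] is known on the period only, which contains the ball. *)
  rewrite (_ : w \_ (ball c d) = (w \_ period) \_ (ball c d)).
    apply/(measurable_restrictT _ mb); apply: measurable_funTS.
    exact/(measurable_restrictT _ measurable_period).
  rewrite -patch_setI; congr (_ \_ _); apply/seteqP; split => [x xb|x []//].
  split => //; move: xb; rewrite /ball/= /period/= in_itv/= ltr_norml.
  by move=> /andP[? ?]; apply/andP; split; lra.
have ae1 : {ae mu, forall x, period x ->
    (fun n => (p n x * w x)%:E) @ \oo --> f x}.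
  (* At the two endpoints of the ball [q x = t], which neither [cvg_step_lt] nor [cvg_step_gt]
     covers; they form a null set. *)
  move: (ae_neq (c + d)) (ae_neq (c - d)).
  apply: filterS2; first exact: (ae_filter_ringOfSetsType mu).
  move=> x xa xb.
  rewrite /period/= in_itv/= => x02.
  apply/fine_cvgP; split; first exact: nearW.
  rewrite /f /=.
  have /andP[q0 q1] := q01 x.
  have -> : (w \_ (ball c d)) x = (if `|x - c| < d then 1 else 0) * w x.
    rewrite patchE; case: ltP => h.
      by rewrite mem_set ?mul1r// /ball/= distrC.
    by rewrite memNset ?mul0r// /ball/= distrC => /lt_geF; rewrite h.
  rewrite /comp /=; apply: cvgM; last exact: cvg_cst.
  case: ltgtP => [h|h|/eqP].
  - by apply: cvg_step_lt => //; rewrite q0 /t /q ltr_pM2r// ltrD2l ltrN2 cos_sub_gt// ltW.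
  - by apply: cvg_step_gt => //; rewrite /t /q ltr_pM2r// ltrD2l ltrN2 cos_sub_lt.
  - rewrite eqr_norml => /andP[/orP[] /eqP e _].
      by move: xa; rewrite -e subrKC eqxx.
    by move: xb; rewrite -e subrKC eqxx.
have iaw : mu.-integrable period (fun x => `|w x|%:E) by exact: integrable_abse iw.
have ae2 : {ae mu, forall x n, period x -> (`|(p n x * w x)%:E| <= `|w x|%:E)%E}.
  apply: aeW => x n _; rewrite lee_fin normrM.
  have /andP[a0 a1] := p01 n x.
  by rewrite ger0_norm// ler_piMl.
have [_ _] := @dominated_convergence _ _ _ mu period measurable_period
  (fun n x => (p n x * w x)%:E) f (fun x => `|w x|%:E)
  (fun n => measurable_int _ (ipw n)) mf ae1 iaw ae2.
have -> : [sequence (\int[mu]_(x in period) (p n x * w x)%:E)%E]_n = cst 0%E.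
  apply/funext => n /=; rewrite -[LHS]fineK.
    by rewrite -[fine _]/(\int[mu]_(x in period) (p n x * w x)) worth.
  by apply: integrable_fin_num; [exact: measurable_period|exact: ipw].
move=> cv0; have h := cvg_unique (@ereal_hausdorff R) (@cvg_cst _ 0%E _ _ _) cv0.
rewrite h (_ : f = (EFin \o w) \_ (ball c d)); last by rewrite restrict_EFin.
rewrite -integral_mkcondr (_ : period `&` ball c d = ball c d)//.
apply/seteqP; split => [x []//|x xb].
split => //; move: xb; rewrite /ball/= /period/= in_itv/= ltr_norml.
by move=> /andP[? ?]; apply/andP; split; lra.
Qed.

Let shrinking_ball (x : R) (n : nat) : set R := ball x n.+1%:R^-1.

Let nicely_shrinking_ball x : nicely_shrinking x (shrinking_ball x).
Proof.
split; first by move=> n; exact: measurable_ball.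
exists (1, fun n => PosNum (ltac:(by rewrite invr_gt0) : 0 < n.+1%:R^-1 :> R)).
split => [|||n]; [by []|exact: cvg_harmonic|by move=> n y|].
by rewrite /= mul1e.
Qed.

(** At almost every point [w] is the limit of its averages over shrinking balls. Around an interior
    point of the period these balls end up inside the period, where the averages are 0; the two
    endpoints are discarded. *)
Lemma rtrigpoly_orthogonal_ae0 (w : R -> R) :
  mu.-integrable period (EFin \o w) ->
  (forall p : R -> R, rtrigpoly p -> \int[mu]_(x in period) (p x * w x) = 0) ->
  {ae mu, forall x, period x -> w x = 0}.
Proof.
move=> iw worth.
have locw := integrable_locally_restrict measurable_period iw.
move: (ae_neq (2 * pi)) (lebesgue_differentiation locw) (ae_neq 0).
apply: filterS3; first exact: (ae_filter_ringOfSetsType mu).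
move=> x x2 lx x0; rewrite /period/= in_itv/= => /andP[x0' x2'].
have {x0 x0'} x0 : 0 < x by rewrite lt_neqAle eq_sym x0.
have {x2 x2'} x2 : x < 2 * pi by rewrite lt_neqAle x2.
have := nice_lebesgue_differentiation nicely_shrinking_ball locw lx.
have -> : (w \_ period) x = w x.
  by rewrite patchE mem_set// /period/= in_itv/= !ltW.
move=> cvw; apply/eqP; rewrite -eqe; apply/eqP.
apply: (cvg_unique (@ereal_hausdorff R) cvw).
have h : 0 < 2 * pi - x by rewrite subr_gt0.
apply: cvg_near_cst; near=> n.
have r0 : 0 < n.+1%:R^-1 :> R by rewrite invr_gt0.
have rx : n.+1%:R^-1 < x.
  by near: n; exact: (near_infty_natSinv_lt (PosNum x0)).
have rx2 : n.+1%:R^-1 < 2 * pi - x.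
  by near: n; exact: (near_infty_natSinv_lt (PosNum h)).
rewrite (_ : integral _ _ _ = 0%E) ?mule0//.
have := @integral_ball_eq0 w x n.+1%:R^-1 iw worth r0 rx.
rewrite addrC -ltrBrDr => /(_ rx2) <-; apply: eq_integral => y.
rewrite inE /shrinking_ball /ball /= ltr_norml => /andP[h1 h2].
rewrite patchE mem_set// /period/= in_itv/=; apply/andP; split.
  by apply: ltW; apply: lt_trans (_ : x - n.+1%:R^-1 < y); rewrite ?subr_gt0// ltrBlDr addrC -ltrBlDr.
by apply: ltW; apply: lt_trans (_ : x + n.+1%:R^-1 < _); rewrite -?ltrBrDl// -ltrBlDl -opprB ltrNl.
Unshelve. all: by end_near. Qed.

(** Testing against real-valued trigonometric polynomials separates the real and imaginary parts of
    [v]. *)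
Lemma fourier_eq0_ae (v : R -> R[i]) : cintegrable period v ->
  (forall n, fourier v n = 0) -> {ae mu, forall x, period x -> v x = 0}.
Proof.
move=> iv v0.
have h p : rtrigpoly p -> \int[mu]_(x in period) (p x * Re (v x)) = 0 /\
                        \int[mu]_(x in period) (p x * Im (v x)) = 0.
  move=> tp; have [] := trigpoly_orthogonal iv v0 tp => hr hi.
  split; [rewrite -[RHS]hr|rewrite -[RHS]hi]; apply: eq_Rintegral => x _.
    by rewrite cReM /= mul0r subr0.
  by rewrite cImM /= mul0r addr0.
have [ir ii] := iv.
have := rtrigpoly_orthogonal_ae0 ii (fun p tp => (h p tp).2).
have := rtrigpoly_orthogonal_ae0 ir (fun p tp => (h p tp).1).
apply: filterS2; first exact: (ae_filter_ringOfSetsType mu).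
by move=> x hr hi px; apply: complex_ext; [exact: hr|exact: hi].
Qed.

Lemma fourierB (u v : R -> R[i]) n : cintegrable period u -> cintegrable period v ->
  fourier (fun x => u x - v x) n = fourier u n - fourier v n.
Proof.
move=> iu iv; rewrite /fourier -mulrBr; congr (_ * _).
have ie f : cintegrable period f ->
    cintegrable period (fun x => expi (- (n%:~R * x)) * f x).
  move=> if_; rewrite (_ : (fun x => expi (- (n%:~R * x)) * f x) =
    fun x => expi (- n%:~R * x) * f x); last by apply/funext => x; rewrite mulNr.
  by apply: cintegrableMl => //; exact: ccontinuous_expi.
rewrite -mulN1r -cintegralZ//; last exact: ie.
rewrite -cintegralD//; [|exact: ie|by apply: cintegrableZ => //; exact: ie].
by congr cintegral; apply/funext => x; rewrite mulN1r mulrBr.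
Qed.

Lemma fourier_inj_ae (u v : R -> R[i]) : cintegrable period u -> cintegrable period v ->
  fourier u =1 fourier v -> {ae mu, forall x, period x -> u x = v x}.
Proof.
move=> iu iv uv.
have iB : cintegrable period (fun x => u x - v x).
  rewrite (_ : (fun x => u x - v x) = fun x => u x + (-1) * v x).
    by apply: cintegrableD => //; exact: cintegrableZ.
  by apply/funext => x; rewrite mulN1r.
have /fourier_eq0_ae : forall n, fourier (fun x => u x - v x) n = 0.
  by move=> n; rewrite fourierB// uv subrr.
move=> /(_ iB); apply: filterS; first exact: (ae_filter_ringOfSetsType mu).
by move=> x h px; apply/eqP; rewrite -subr_eq0; apply/eqP; exact: h.
Qed.

End fourier_uniqueness.


(** * The quartic integral of a trigonometric polynomial *)

Section trigonometric_sums.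
Context {R : realType}.
Let mu := @lebesgue_measure R.
Local Notation Re := complex.Re.
Local Notation Im := complex.Im.
Local Notation normc := Normc.normc.

Lemma cintegral_real (D : set R) (f : R -> R) :
  cintegral D (fun x => (f x)%:C) = (\int[mu]_(x in D) f x)%:C.
Proof.
apply: complex_ext => //=.
by rewrite /Rintegral integral0.
Qed.

Definition trigsum (J : finType) (C : J -> R[i]) (alpha : J -> R) (x : R) :=
  \sum_j C j * expi (alpha j * x).

Lemma ccontinuous_trigsum (J : finType) (C : J -> R[i]) (alpha : J -> R) :
  ccontinuous (trigsum C alpha).
Proof.
apply: ccontinuous_sum => j; apply: ccontinuousM; first exact: ccontinuous_cst.
exact: ccontinuous_expi.
Qed.

Lemma ccontinuous_normc_sqr (f : R -> R[i]) : ccontinuous f ->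
  continuous (fun x => normc (f x) ^+ 2).
Proof.
move=> cf; rewrite (_ : (fun x => normc (f x) ^+ 2) = fun x => Re (f x * conjc (f x))).
  by have [] := ccontinuousM cf (ccontinuous_conj cf).
by apply/funext => x; rewrite -normc_sqrC.
Qed.

(** Orthogonality with repeated frequencies: for the square of a wave the indices are pairs, and
    different pairs may have the same frequency, hence the inner sum over [alpha p == alpha q]. *)
Lemma integral_sqr_trigsum (J : finType) (C : J -> R[i]) (alpha : J -> R) b :
  0 < b -> (forall p q, expi ((alpha p - alpha q) * b) = 1) ->
  (\int[mu]_(x in `[0, b]) normc (trigsum C alpha x) ^+ 2)%:C =
  b%:C * \sum_p \sum_(q | alpha p == alpha q) C p * conjc (C q).
Proof.
move=> b0 per; rewrite -cintegral_real.
transitivity (cintegral `[0, b] (fun x =>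
    \sum_p \sum_q (C p * conjc (C q)) * expi ((alpha p - alpha q) * x))).
  congr cintegral; apply/funext => x; rewrite normc_sqrC /trigsum conjc_sum.
  rewrite big_distrlr; apply: eq_bigr => p _; apply: eq_bigr => q _ /=.
  by rewrite conjcM conjc_expi mulrACA -expiD mulrBl.
have ii p q : cintegrable `[0, b]
    (fun x => C p * conjc (C q) * expi ((alpha p - alpha q) * x)).
  apply: ccontinuous_integrable; apply: ccontinuousM.
    exact: ccontinuous_cst.
  exact: ccontinuous_expi.
rewrite cintegral_sum//; last by move=> p; exact: cintegrable_sum.
rewrite mulr_sumr; apply: eq_bigr => p _.
rewrite cintegral_sum// [in RHS]big_mkcond mulr_sumr; apply: eq_bigr => q _.
rewrite cintegralZ//; last first.
  by apply: ccontinuous_integrable; exact: ccontinuous_expi.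
rewrite cintegral_expi// subr_eq0; case: ifP => _; first by rewrite mulrC.
by rewrite !mulr0.
Qed.

Lemma trigsum_sqr (I : finType) (c : I -> R[i]) (k : I -> R) x :
  trigsum c k x * trigsum c k x =
  trigsum (fun p : I * I => c p.1 * c p.2) (fun p => k p.1 + k p.2) x.
Proof.
rewrite /trigsum big_distrlr pair_bigA; apply: eq_bigr => p _ /=.
by rewrite mulrACA -expiD mulrDl.
Qed.

Definition schrodinger_coef (I : Type) (a : I -> R[i]) (k : I -> int) (t : R) i :=
  expi (- ((k i)%:~R ^+ 2 * t)) * a i.

Definition wave (I : finType) (a : I -> R[i]) (k : I -> int) (t : R) :=
  trigsum (schrodinger_coef a k t) (fun i => (k i)%:~R).

(** Eliminating [b] from the second equation leaves [2 (a - c) (a - d) = 0]. *)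
Lemma sum_eq_sqr_eq (a b c d : int) :
  a + b = c + d -> a ^+ 2 + b ^+ 2 = c ^+ 2 + d ^+ 2 ->
  (a == c) && (b == d) || (a == d) && (b == c).
Proof.
move=> h1 h2; have hb : b = c + d - a by rewrite -h1; ring.
have : (a - c) * (a - d) = 0.
  by apply: (@mulIf _ 2) => //; rewrite hb in h2; rewrite mul0r; lra.
move=> /eqP; rewrite mulf_eq0 !subr_eq0 => /orP[/eqP e|/eqP e].
  by rewrite hb e eqxx addrC addKr eqxx.
by rewrite hb e eqxx addrK eqxx orbT.
Qed.

(** * Resonant pairs and the fourth power of a wave *)

Section quartic.
Context (I : finType) (a : I -> R[i]) (k : I -> int) (k_inj : injective k).

(** Coefficient at time 0, space frequency and, up to sign, time frequency of the term of index [p]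
    in the square of the wave. *)
Let A (p : I * I) := a p.1 * a p.2.
Let s (p : I * I) : int := k p.1 + k p.2.
Let e (p : I * I) : int := k p.1 ^+ 2 + k p.2 ^+ 2.

Definition mass := \sum_i normc (a i) ^+ 2.

Lemma resonant_sum :
  \sum_p \sum_(q | (s p == s q) && (e p == e q)) A p * conjc (A q) =
  (2 * mass ^+ 2 - \sum_i normc (a i) ^+ 4)%:C.
Proof.
have cond p q : (s p == s q) && (e p == e q) = (q == p) || (q == (p.2, p.1)).
  case: p => p1 p2; case: q => q1 q2; rewrite /s /e /= !xpair_eqE.
  apply/idP/idP => [/andP[/eqP h1 /eqP h2]|].
    have := sum_eq_sqr_eq h1 h2.
    by rewrite !(inj_eq k_inj) ![p1 == _]eq_sym ![p2 == _]eq_sym orbC andbC orbC [X in _ || X]andbC.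
  move=> /orP[] /andP[/eqP-> /eqP->]; rewrite ?eqxx//.
  by rewrite addrC eqxx addrC eqxx.
have AA p : A p * conjc (A p) = (normc (a p.1) ^+ 2 * normc (a p.2) ^+ 2)%:C.
  by rewrite realcM !normc_sqrC /A conjcM mulrACA.
(* The two solutions [q = p] and [q = (p.2, p.1)] contribute equally but coincide on the diagonal,
   where one copy must be taken back. These corrections add up to the sum of fourth powers. *)
pose diag (p : I * I) := if p.1 == p.2 then A p * conjc (A p) else 0.
transitivity (\sum_(p : I * I) (A p * conjc (A p) *+ 2 - diag p)).
  apply: eq_bigr => -[p1 p2] _; under eq_bigl => q do rewrite cond.
  rewrite (bigD1 (p1, p2)) ?eqxx//= /diag /=.
  have [->|ne] := eqVneq p1 p2.
    rewrite big_pred0 ?addr0 ?mulr2n ?addrK// => q.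
    by rewrite orbb andbN.
  rewrite (big_pred1 (p2, p1)); last first.
    move=> q /=; have [->|] := eqVneq q (p2, p1); last by rewrite orbF andbN.
    by rewrite orbT xpair_eqE eq_sym negb_and ne.
  by rewrite subr0 mulr2n /A /= (mulrC (a p2)).
rewrite big_split/= sumrN realcB; congr (_ - _).
  have -> : mass ^+ 2 = \sum_(p : I * I) normc (a p.1) ^+ 2 * normc (a p.2) ^+ 2.
    by rewrite expr2 /mass big_distrlr pair_bigA.
  rewrite sumrMnl; under eq_bigr do rewrite AA.
  by rewrite -realc_sum mulr2n; apply: complex_ext => /=; ring.
rewrite /diag -(pair_bigA _ (fun i j => if i == j then A (i, j) * conjc (A (i, j)) else 0))/=.
rewrite realc_sum; apply: eq_bigr => i _.
rewrite (bigD1 i)//= eqxx big1 ?addr0; last by move=> j ji; rewrite eq_sym (negPf ji).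
by rewrite AA -exprD.
Qed.



Definition wave_pow4 t := \int[mu]_(x in period) normc (wave a k t x) ^+ 4.

(** [|f|^4 = |f^2|^2], and the square of a wave is again a trigonometric sum, indexed by pairs, so
    the quadratic formula applies to it. *)
Lemma wave_pow4E t : (wave_pow4 t)%:C = (2 * pi)%:C * (\sum_p \sum_(q | s p == s q)
  A p * conjc (A q) * expi (((e q)%:~R - (e p)%:~R) * t)).
Proof.
have pi20 : 0 < 2 * pi :> R by rewrite mulr_gt0// pi_gt0.
pose C p := schrodinger_coef a k t p.1 * schrodinger_coef a k t p.2.
rewrite (_ : wave_pow4 t = \int[mu]_(x in `[0, 2 * pi])
    normc (trigsum C (fun p : I * I => (k p.1)%:~R + (k p.2)%:~R) x) ^+ 2).
  rewrite integral_sqr_trigsum//; last first.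
    by move=> p q; rewrite -!intrD -intrB expi_pi_mul2.
  congr (_ * _); apply: eq_bigr => p _; apply: eq_big => q.
    by rewrite -!intrD eqr_int.
  move=> _; rewrite /C /A /schrodinger_coef !conjcM !conjc_expi.
  rewrite (_ : expi (((e q)%:~R - (e p)%:~R) * t) =
    expi (- ((k p.1)%:~R ^+ 2 * t)) * expi (- ((k p.2)%:~R ^+ 2 * t)) *
    (expi (- - ((k q.1)%:~R ^+ 2 * t)) * expi (- - ((k q.2)%:~R ^+ 2 * t)))).
    by ring.
  rewrite -!expiD; congr expi; rewrite /e !intrD !rmorphXn /=; ring.
apply: eq_Rintegral => x _.
rewrite (_ : trigsum C _ x = wave a k t x * wave a k t x); last first.
  by rewrite /wave trigsum_sqr.
by rewrite Normc.normcM; ring.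
Qed.

(** Continuity in [t] is read off the expansion [wave_pow4E], a finite sum of exponentials in
    [t]. *)
Lemma continuous_wave_pow4 : continuous wave_pow4.
Proof.
rewrite (_ : wave_pow4 = fun t => Re ((2 * pi)%:C * (\sum_p \sum_(q | s p == s q)
    A p * conjc (A q) * expi (((e q)%:~R - (e p)%:~R) * t)))).
  suff [] : ccontinuous (fun t : R => (2 * pi)%:C * (\sum_p \sum_(q | s p == s q)
    A p * conjc (A q) * expi (((e q)%:~R - (e p)%:~R) * t))) by [].
  apply: ccontinuousM; first exact: ccontinuous_cst.
  apply: ccontinuous_sum => p.
  rewrite (_ : (fun t : R => _) = fun t => \sum_q (if s p == s q then
     A p * conjc (A q) else 0) * expi (((e q)%:~R - (e p)%:~R) * t)).
    apply: ccontinuous_sum => q; apply: ccontinuousM; first exact: ccontinuous_cst.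
    exact: ccontinuous_expi.
  apply/funext => t; rewrite big_mkcond; apply: eq_bigr => q _.
  by case: ifP; rewrite ?mul0r.
by apply/funext => t; rewrite -wave_pow4E.
Qed.

(** A square has the parity of its root, so [e] has the parity of [s]. The explicit half comes from
    eliminating [k p.1]. *)
Lemma resonance_even p q : s p = s q -> exists m : int, e p - e q = 2 * m.
Proof.
rewrite /s /e => h.
have -> : k p.1 = k q.1 + k q.2 - k p.2 by rewrite -h; ring.
by exists (k q.1 * k q.2 + k p.2 ^+ 2 - k p.2 * (k q.1 + k q.2)); ring.
Qed.

Lemma integral_wave_pow4 (N : nat) : (0 < N)%N ->
  \int[mu]_(t in `[0, N%:R * pi]) wave_pow4 t =
  N%:R * (2 * pi ^+ 2) * (2 * mass ^+ 2 - \sum_i normc (a i) ^+ 4).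
Proof.
move=> N0; have Npi : 0 < N%:R * pi :> R by rewrite mulr_gt0 ?ltr0n ?pi_gt0.
apply: (@complexI R); rewrite -cintegral_real.
have cc p q : ccontinuous (fun t : R => expi (((e q)%:~R - (e p)%:~R) * t)).
  exact: ccontinuous_expi.
pose z p q := if s p == s q then A p * conjc (A q) else 0.
have iz p q : cintegrable `[0, N%:R * pi]
    (fun t : R => z p q * expi (((e q)%:~R - (e p)%:~R) * t)).
  by apply: ccontinuous_integrable; apply: ccontinuousM => //; exact: ccontinuous_cst.
rewrite (_ : (fun t => (wave_pow4 t)%:C) = fun t => (2 * pi)%:C *
    \sum_p \sum_q z p q * expi (((e q)%:~R - (e p)%:~R) * t)); last first.
  apply/funext => t; rewrite wave_pow4E; congr (_ * _); apply: eq_bigr => p _.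
  rewrite big_mkcond; apply: eq_bigr => q _; rewrite /z.
  by case: ifP; rewrite ?mul0r.
rewrite cintegralZ//; last first.
  by apply: cintegrable_sum => // p; exact: cintegrable_sum.
rewrite cintegral_sum//; last by move=> p; exact: cintegrable_sum.
rewrite [RHS]realcM -resonant_sum.
rewrite (_ : (N%:R * (2 * pi ^+ 2))%:C = (2 * pi)%:C * (N%:R * pi)%:C); last first.
  by rewrite -realcM; congr (_%:C); ring.
rewrite -mulrA; congr (_ * _); rewrite mulr_sumr; apply: eq_bigr => p _.
rewrite cintegral_sum// mulr_sumr [RHS]big_mkcond; apply: eq_bigr => q _.
rewrite /z; case: eqP => [spq|_]; last first.
  by rewrite (_ : (fun t => _) = fun=> 0) ?cintegral0//; apply/funext => t; rewrite mul0r.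
rewrite cintegralZ//; last exact: ccontinuous_integrable.
rewrite cintegral_expi//; last first.
  (* An even time frequency has [pi] as a period, so [[0, N pi]] is a whole number of periods. *)
  rewrite -intrB; have [m ->] := resonance_even (esym spq).
  rewrite (_ : (2 * m)%:~R * (N%:R * pi) = (m * N%:Z)%:~R * (2 * pi)).
    exact: expi_pi_mul2.
  by rewrite !intrM -pmulrn; ring.
rewrite subr_eq0 eqr_int eq_sym; case: ifP => _; last by rewrite mulr0.
by rewrite mulrC.
Qed.

End quartic.
End trigonometric_sums.


(** * Almost everywhere convergence of partial Fourier sums *)

Section telescoping.
Context {R : realType}.
Implicit Types u h : R^nat.

Lemma sum_increments u n : u n = u 0%N + \sum_(0 <= i < n) (u i.+1 - u i).
Proof. by rewrite telescope_sumr// subrKC. Qed.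

Lemma ler_increments u h n : (forall j, `|u j.+1 - u j| <= h j) ->
  `|u n| <= `|u 0%N| + \sum_(0 <= i < n) h i.
Proof.
move=> uh; rewrite (sum_increments u n).
apply: (le_trans (ler_normD _ _)); rewrite lerD2l.
by apply: (le_trans (ler_norm_sum _ _ _)); exact: ler_sum.
Qed.

(** Absolute convergence of the telescoping series. *)
Lemma cvgn_increments u h : (forall j, `|u j.+1 - u j| <= h j) ->
  (\sum_(0 <= j <oo) (h j)%:E < +oo)%E -> cvgn u.
Proof.
move=> uh hoo; pose d : R^nat := fun j => u j.+1 - u j.
have h0 j : 0 <= h j by apply: le_trans (uh j).
have cd : cvgn (series d).
  apply: normed_cvg; apply: nondecreasing_is_cvgn.
    by apply: nondecreasing_series => n _ _; exact: normr_ge0.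
  exists (fine (\sum_(0 <= j <oo) (h j)%:E)%E) => _ [n _ <-].
  rewrite -lee_fin fineK; last first.
    by rewrite ge0_fin_numE//; apply: nneseries_ge0 => j _ _; rewrite lee_fin.
  apply: (@le_trans _ _ (\sum_(0 <= j < n) (h j)%:E)%E).
    rewrite sumEFin lee_fin /series /=.
    by apply: ler_sum => j _; exact: uh.
  by apply: nneseries_lim_ge => j _ _; rewrite lee_fin.
rewrite (_ : u = fun n => u 0%N + series d n).
  by apply: is_cvgD => //; exact: is_cvg_cst.
by apply/funext => n; rewrite [LHS]sum_increments.
Qed.

End telescoping.

(** * Dominated convergence towards a limit not given in advance *)

Section dominated_limit.
Context d (T : measurableType d) {R : realType}.
Variables (mu : {measure set T -> \bar R}) (D : set T) (mD : measurable D).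

(** The bounded factor [b] will be the real or imaginary part of an exponential, so that Fourier
    coefficients pass to the limit. *)
Lemma dominated_limit (u : nat -> T -> R) (g : T -> \bar R) :
  (forall j, measurable_fun D (u j)) -> mu.-integrable D g ->
  (forall j x, D x -> (`|u j x|%:E <= g x)%E) ->
  {ae mu, forall x, D x -> cvgn (u ^~ x)} ->
  exists U : T -> R, [/\ mu.-integrable D (fun x => (U x)%:E),
    {ae mu, forall x, D x -> u ^~ x @ \oo --> U x} &
    forall b : T -> R, measurable_fun D b -> (forall x, `|b x| <= 1) ->
      \int[mu]_(x in D) (b x * u n x) @[n --> \oo] -->
      \int[mu]_(x in D) (b x * U x)].
Proof.
move=> mu_ ig dom cvu.
(* The upper limit is measurable on all of [D], including the null set without convergence, and is
   the limit elsewhere. *)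
pose U x := fine (limn_esup (fun j => (u j x)%:E)).
have mU : measurable_fun D U.
  apply: measurableT_comp; first exact: fine_measurable.
  by apply: measurable_fun_limn_esup => n; exact/measurable_EFinP.
have aeU : {ae mu, forall x, D x -> u ^~ x @ \oo --> U x}.
  move: cvu; apply: filterS.
  move=> x h /h cu; have : (u j x)%:E @[j --> \oo] --> (limn (u^~ x))%:E.
    by apply/fine_cvgP; split => //; exact: nearW.
  by move=> /cvg_limn_einf_sup[_]; rewrite /U => ->.
have dct (b : T -> R) : measurable_fun D b -> (forall x, `|b x| <= 1) ->
    mu.-integrable D (fun x => (b x * U x)%:E) /\
    \int[mu]_(x in D) (b x * u n x) @[n --> \oo] -->
      \int[mu]_(x in D) (b x * U x).
  move=> mb b1.
  have mbu n : measurable_fun D (fun x => (b x * u n x)%:E).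
    by apply/measurable_EFinP; apply: measurable_funM.
  have mbU : measurable_fun D (fun x => (b x * U x)%:E).
    by apply/measurable_EFinP; apply: measurable_funM.
  have ae1 : {ae mu, forall x, D x ->
      (fun n => (b x * u n x)%:E) @ \oo --> (b x * U x)%:E}.
    move: aeU; apply: filterS.
    move=> x h /h ux; apply/fine_cvgP; split; first exact: nearW.
    by apply: cvgM => //; exact: cvg_cst.
  have ae2 : {ae mu, forall x n, D x -> (`|(b x * u n x)%:E| <= g x)%E}.
    apply: aeW => x n Dx; apply: le_trans (dom n x Dx).
    by rewrite lee_fin normrM ler_piMl.
  have [ibU _ cv] := dominated_convergence mD mbu mbU ae1 ig ae2.
  split => //; apply: fine_cvg; rewrite fineK//.
  exact: integrable_fin_num.
exists U; split => //; last by move=> b mb b1; have [] := dct b mb b1.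
(* The factor [1] gives the integrability of [U] itself. *)
have [| + _] := dct (fun=> 1) (measurable_cst _); first by move=> x; rewrite normr1.
by under eq_fun do rewrite mul1r.
Qed.

End dominated_limit.

(** The enumeration 0, -1, 1, -2, 2, ... of the integers; it turns sets of frequencies into initial
    segments of [nat]. *)
Definition zigzag (n : nat) : int := if odd n then Negz n./2 else Posz n./2.

Lemma zigzag_inj : injective zigzag.
Proof.
move=> m n; rewrite /zigzag; case: ifP => om; case: ifP => on // [] mn;
  by rewrite -(odd_double_half m) -(odd_double_half n) om on mn.
Qed.

Lemma zigzag_surj (m : int) : exists n, zigzag n = m.
Proof.
case: m => n.
  by exists n.*2; rewrite /zigzag odd_double doubleK.
by exists n.*2.+1; rewrite /zigzag /= odd_double /= uphalf_double.
Qed.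

(** * Partial Fourier sums along the enumeration of the integers *)

Section partial_sums.
Context {R : realType}.
Let mu := @lebesgue_measure R.
Local Notation Re := complex.Re.
Local Notation Im := complex.Im.
Local Notation normc := Normc.normc.
Implicit Types (c : nat -> R[i]).

Definition fourier_sum c (K : nat) (x : R) : R[i] :=
  \sum_(0 <= i < K) c i * expi ((zigzag i)%:~R * x).

Lemma fourier_sum_trigsum c K : fourier_sum c K =
  trigsum (fun i : 'I_K => c i) (fun i : 'I_K => (zigzag i)%:~R).
Proof. by apply/funext => x; rewrite /fourier_sum big_mkord. Qed.

Lemma ccontinuous_fourier_sum c K : ccontinuous (fourier_sum c K).
Proof. by rewrite fourier_sum_trigsum; exact: ccontinuous_trigsum. Qed.

(** A block of terms is recast as a partial sum with its first coefficients erased, so that the norm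
    formula covers increments too. *)
Lemma fourier_sumB c K L x : (K <= L)%N ->
  fourier_sum c L x - fourier_sum c K x =
  fourier_sum (fun i => if (K <= i)%N then c i else 0) L x.
Proof.
move=> KL; rewrite /fourier_sum (@big_cat_nat _ _ _ K 0 L)//= addrAC subrr add0r.
rewrite [RHS](@big_cat_nat _ _ _ K 0 L)//=.
rewrite (_ : \sum_(0 <= i < K) _ * _ = 0) ?add0r; last first.
  by rewrite big_nat big1// => i /andP[_ iK]; rewrite leqNgt iK mul0r.
by apply: eq_big_nat => i /andP[-> _].
Qed.

Lemma pi2_gt0 : 0 < 2 * pi :> R.
Proof. by rewrite mulr_gt0// pi_gt0. Qed.

Lemma integral_fourier_sum_sqr c K :
  \int[mu]_(x in period) normc (fourier_sum c K x) ^+ 2 =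
  2 * pi * \sum_(0 <= i < K) normc (c i) ^+ 2.
Proof.
apply: (@complexI R).
rewrite fourier_sum_trigsum integral_sqr_trigsum ?pi2_gt0//; last first.
  by move=> p q; rewrite -intrB expi_pi_mul2.
rewrite [RHS]realcM; congr (_ * _); rewrite big_mkord realc_sum.
apply: eq_bigr => i _; rewrite (big_pred1 i) ?normc_sqrC// => j.
by rewrite eqr_int (inj_eq zigzag_inj) eq_sym.
Qed.

Lemma fourier_fourier_sum c K n : fourier (fourier_sum c K) (zigzag n) =
  if (n < K)%N then c n else 0.
Proof.
rewrite /fourier (_ : (fun x => _) = fun x => \sum_(i < K) c i *
    expi (((zigzag i)%:~R - (zigzag n)%:~R) * x)); last first.
  apply/funext => x; rewrite /fourier_sum big_mkord mulr_sumr; apply: eq_bigr => i _.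
  by rewrite mulrCA -expiD mulrBl addrC.
rewrite cintegral_sum; last 2 first.
- exact: measurable_period.
- move=> i; apply: ccontinuous_integrable; apply: ccontinuousM.
    exact: ccontinuous_cst.
  exact: ccontinuous_expi.
transitivity (\sum_(i < K) if (i == n :> nat) then c i else 0).
  rewrite mulr_sumr; apply: eq_bigr => i _; rewrite cintegralZ; last 2 first.
  - exact: measurable_period.
  - by apply: ccontinuous_integrable; exact: ccontinuous_expi.
  rewrite cintegral_expi ?pi2_gt0//; last by rewrite -intrB expi_pi_mul2.
  rewrite subr_eq0 eqr_int (inj_eq zigzag_inj); case: ifP => _; last by rewrite !mulr0.
  by rewrite mulrCA -realcM mulVf ?mulr1// gt_eqF ?pi2_gt0.
case: ltnP => nK.
  rewrite (bigD1 (Ordinal nK))//= eqxx big1 ?addr0// => i.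
  by rewrite -val_eqE /= => /negPf ->.
by rewrite big1// => i _; rewrite ltn_eqF// (leq_trans (ltn_ord i)).
Qed.

End partial_sums.


(** * Bessel's inequality and almost everywhere convergence *)

Section L2_convergence.
Context {R : realType}.
Let mu := @lebesgue_measure R.
Local Notation Re := complex.Re.
Local Notation Im := complex.Im.
Local Notation normc := Normc.normc.
Implicit Types (v : R -> R[i]) (c : nat -> R[i]).

Lemma measurable_normc_sqr v : cmeasurable v ->
  measurable_fun setT (fun x => normc (v x) ^+ 2).
Proof.
move=> [mr mi]; rewrite (_ : (fun x => _) = fun x => Re (v x) ^+ 2 + Im (v x) ^+ 2).
  by apply: measurable_funD; exact: measurable_funX.
by apply/funext => x; rewrite normc_sqr.
Qed.

Lemma L2T_integrable_sqr v : L2T v ->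
  mu.-integrable period (fun x => (normc (v x) ^+ 2)%:E).
Proof.
move=> [mv _ fv]; apply/integrableP; split.
  by apply/measurable_EFinP; apply: measurable_funTS; exact: measurable_normc_sqr.
apply: le_lt_trans fv; rewrite le_eqVlt; apply/orP; left; apply/eqP.
by apply: eq_integral => x _; rewrite gee0_abs// lee_fin sqr_ge0.
Qed.

Lemma measure_period : fine (mu period) = 2 * pi.
Proof. by rewrite /period /mu lebesgue_measure_itv/= lte_fin pi2_gt0 -EFinB/= subr0. Qed.

Lemma ler_sqr1 (y : R) : 0 <= y -> y <= 1 + y ^+ 2.
Proof. by move=> y0; rewrite expr2; nra. Qed.

Lemma integrable_cst_period (r : R) : mu.-integrable period (fun=> r%:E).
Proof. by apply: continuous_integrable; exact: cst_continuous. Qed.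

(** On a set of finite measure the majorant [1 + |v|^2] of [|v|] is integrable. *)
Lemma L2T_cintegrable v : L2T v -> cintegrable period v.
Proof.
move=> L2v; have [[mr mi] _ _] := L2v.
have ig : mu.-integrable period (fun x => (1%:E + (normc (v x) ^+ 2)%:E)%E).
  by apply: integrableD => //; [exact: integrable_cst_period|exact: L2T_integrable_sqr].
have bd x (y : R) : `|y| <= normc (v x) ->
    (`|y%:E| <= `|1%:E + (normc (v x) ^+ 2)%:E|)%E.
  move=> h; rewrite -EFinD !abse_EFin lee_fin; apply: (le_trans h).
  by apply: le_trans (ler_norm _); apply: ler_sqr1; exact: normc_ge0.
split; apply: le_integrable ig => //.
- by apply/measurable_EFinP; exact: measurable_funTS.
- by move=> x _; apply: bd; exact: normc_Re.
- by apply/measurable_EFinP; exact: measurable_funTS.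
- by move=> x _; apply: bd; exact: normc_Im.
Qed.

Lemma cintegral_conj_fourier_sum v c K : cintegrable period v ->
  cintegral period (fun x => conjc (fourier_sum c K x) * v x) =
  (2 * pi)%:C * \sum_(0 <= i < K) conjc (c i) * fourier v (zigzag i).
Proof.
move=> iv.
have ie (i : nat) : cintegrable period (fun x => expi (- (zigzag i)%:~R * x) * v x).
  by apply: cintegrableMl => //; exact: ccontinuous_expi.
rewrite (_ : (fun x => _) = fun x => \sum_(0 <= i < K)
    conjc (c i) * (expi (- (zigzag i)%:~R * x) * v x)); last first.
  apply/funext => x; rewrite /fourier_sum conjc_sum mulr_suml.
  by apply: eq_bigr => i _; rewrite conjcM conjc_expi mulNr mulrA.
rewrite cintegral_sum//; last by move=> i; apply: cintegrableZ.
rewrite mulr_sumr; apply: eq_bigr => i _; rewrite cintegralZ//.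
rewrite mulrCA; congr (_ * _); rewrite /fourier mulrA -realcM.
rewrite mulfV ?gt_eqF ?pi2_gt0// mul1r.
by congr cintegral; apply/funext => x; rewrite mulNr.
Qed.

(** The integral of [|v - S|^2] is nonnegative, and in its expansion the cross term is minus twice
    the integral of [|S|^2]. *)
Lemma bessel v K : L2T v ->
  \sum_(0 <= i < K) normc (fourier v (zigzag i)) ^+ 2 <=
  (2 * pi)^-1 * \int[mu]_(x in period) normc (v x) ^+ 2.
Proof.
move=> L2v; have iv := L2T_cintegrable L2v; have iv2 := L2T_integrable_sqr L2v.
pose c i := fourier v (zigzag i); pose S := fourier_sum c K.
have cS : ccontinuous S by exact: ccontinuous_fourier_sum.
have icross : cintegrable period (fun x => conjc (S x) * v x).
  by apply: cintegrableMl => //; exact: ccontinuous_conj.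
have iS2 : mu.-integrable period (fun x => (normc (S x) ^+ 2)%:E).
  by apply: continuous_integrable; exact: ccontinuous_normc_sqr.
have cross : \int[mu]_(x in period) Re (conjc (S x) * v x) =
    2 * pi * \sum_(0 <= i < K) normc (c i) ^+ 2.
  have := cintegral_conj_fourier_sum c K iv.
  rewrite (_ : \sum_(0 <= i < K) _ = (\sum_(0 <= i < K) normc (c i) ^+ 2)%:C).
    by rewrite -realcM => /(congr1 (fun z => Re z)).
  by rewrite realc_sum; apply: eq_bigr => i _; rewrite normc_sqrC mulrC.
have : 0 <= \int[mu]_(x in period) normc (v x - S x) ^+ 2.
  by apply: Rintegral_ge0 => x _; exact: sqr_ge0.
rewrite (_ : \int[mu]_(x in period) _ = \int[mu]_(x in period)
   (normc (v x) ^+ 2 - 2 * Re (conjc (S x) * v x) + normc (S x) ^+ 2)); last first.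
  apply: eq_Rintegral => x _; rewrite !normc_sqr.
  by case: (v x) => v1 v2; case: (S x) => s1 s2 /=; ring.
have i2cross : mu.-integrable period (fun x => (2 * Re (conjc (S x) * v x))%:E).
  have := @integrableZl _ _ _ mu period _ 2 _ icross.1; exact.
have i12 : mu.-integrable period
    (fun x => (normc (v x) ^+ 2 - 2 * Re (conjc (S x) * v x))%:E).
  rewrite (_ : (fun x => _) = fun x => ((normc (v x) ^+ 2)%:E -
    (2 * Re (conjc (S x) * v x))%:E)%E); last by apply/funext => x; rewrite EFinB.
  exact: integrableB.
rewrite RintegralD//.
rewrite RintegralB// RintegralZl//; last exact: icross.1.
rewrite cross /S integral_fourier_sum_sqr => h.
rewrite ler_pdivlMl ?pi2_gt0//; move: h; rewrite -/c; lra.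
Qed.

(* The quadratic majorant of [normc] given by [ler_young] replaces the
   Cauchy-Schwarz inequality. *)
Lemma integral_normc_majorant (f : R -> R[i]) (e A : R) : 0 < e -> ccontinuous f ->
  \int[mu]_(x in period) normc (f x) ^+ 2 <= 2 * pi * A ->
  (\int[mu]_(x in period) ((e + e^-1 * normc (f x) ^+ 2) / 2)%:E <=
   (pi * (e + e^-1 * A))%:E)%E.
Proof.
move=> e0 cf fA.
have if2 : mu.-integrable period (EFin \o (fun x => normc (f x) ^+ 2)).
  by apply: continuous_integrable; exact: ccontinuous_normc_sqr.
have ic : mu.-integrable period (EFin \o (fun=> e)) by exact: integrable_cst_period.
have ief : mu.-integrable period (EFin \o (fun x => e^-1 * normc (f x) ^+ 2)).
  by have := @integrableZl _ _ _ mu period _ e^-1 _ if2; exact.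
have isum : mu.-integrable period (EFin \o (fun x => e + e^-1 * normc (f x) ^+ 2)).
  by have := @integrableD _ _ _ mu period _ _ _ ic ief; exact.
have ih : mu.-integrable period
    (EFin \o (fun x => (e + e^-1 * normc (f x) ^+ 2) / 2)).
  rewrite (_ : _ \o _ = fun x => (2^-1%:E * (e + e^-1 * normc (f x) ^+ 2)%:E)%E).
    exact: integrableZl.
  by apply/funext => x /=; rewrite -EFinM mulrC.
rewrite -[leLHS]fineK; last first.
  by apply: (@integrable_fin_num _ _ _ mu period _ _ ih).
rewrite lee_fin -[leLHS]/(\int[mu]_(x in period) ((e + e^-1 * normc (f x) ^+ 2) / 2)).
rewrite RintegralZr// RintegralD// RintegralZl//.
rewrite Rintegral_cst// measure_period.
have : e^-1 * \int[mu]_(x in period) normc (f x) ^+ 2 <= e^-1 * (2 * pi * A).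
  by rewrite ler_wpM2l// invr_ge0 ltW.
rewrite /period; lra.
Qed.

Lemma ler_young (y e : R) : 0 < e -> y <= (e + e^-1 * y ^+ 2) / 2.
Proof.
move=> e0; rewrite ler_pdivlMr// -(ler_pM2l e0) [leRHS]mulrDr.
have -> : e * (e^-1 * y ^+ 2) = y ^+ 2 by rewrite mulrA divff ?gt_eqF// mul1r.
by have := sqr_ge0 (y - e); rewrite -subr_ge0 !expr2; nra.
Qed.

Lemma nneseries_geometric_lty (a : R) : 0 <= a ->
  (\sum_(0 <= j <oo) (a * 2^-1 ^+ j)%:E < +oo)%E.
Proof.
move=> a0; apply: (@le_lt_trans _ _ (2 * a)%:E); last exact: ltry.
apply: lime_le.
  by apply: is_cvg_nneseries => n _ _; rewrite lee_fin mulr_ge0// exprn_ge0.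
apply: nearW => n; rewrite sumEFin lee_fin.
have -> : \sum_(0 <= i < n) a * 2^-1 ^+ i = series (geometric a 2^-1) n by [].
rewrite geometric_seriesE ?lt_eqF ?invf_lt1 ?ltr1n//=.
have : 0 <= 2^-1 ^+ n :> R by rewrite exprn_ge0.
set z := _ ^+ n => z0; have -> : (1 - 2^-1 : R) = 2^-1 by lra.
rewrite invrK; nra.
Qed.

(** The shape in which the real-valued limits of [dominated_limit] can be applied term by term. *)
Lemma cintegralM_parts w f : ccontinuous w -> cintegrable period f ->
  cintegral period (fun x => w x * f x) =
  (\int[mu]_(x in period) (Re (w x) * Re (f x)) -
   \int[mu]_(x in period) (Im (w x) * Im (f x))) +i*
  (\int[mu]_(x in period) (Re (w x) * Im (f x)) +
   \int[mu]_(x in period) (Im (w x) * Re (f x))).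
Proof.
move=> [wr wi] [fr fi]; apply: complex_ext => /=.
  rewrite -RintegralB//; try exact: integrable_continuousM.
  by apply: eq_Rintegral => x _; rewrite cReM.
rewrite -RintegralD//; try exact: integrable_continuousM.
by apply: eq_Rintegral => x _; rewrite cImM.
Qed.

(** The block bounds make the sum of the increments integrable, hence finite almost everywhere, so
    the sums converge there. Their limit has the coefficients of [v], hence is [v] by uniqueness. *)
Lemma ae_cvg_fourier_sum v (K : nat -> nat) : cintegrable period v ->
  {homo K : i j / (i <= j)%N} -> (forall j, (j <= K j)%N) ->
  (forall j, \sum_(K j <= i < K j.+1) normc (fourier v (zigzag i)) ^+ 2 <=
    4^-1 ^+ j) ->
  {ae mu, forall x, period x ->
    Re (fourier_sum (fun i => fourier v (zigzag i)) (K j) x) @[j --> \oo]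
      --> Re (v x) /\
    Im (fourier_sum (fun i => fourier v (zigzag i)) (K j) x) @[j --> \oo]
      --> Im (v x)}.
Proof.
move=> iv ndK Kge tail.
pose c i := fourier v (zigzag i); pose S j := fourier_sum c (K j).
pose D j x := S j.+1 x - S j x.
pose c' j i := if (K j <= i)%N then c i else 0.
have DE j : D j = fourier_sum (c' j) (K j.+1).
  by apply/funext => x; rewrite /D /S fourier_sumB// ndK.
have cS j : ccontinuous (S j) by exact: ccontinuous_fourier_sum.
have cD j : ccontinuous (D j) by rewrite DE; exact: ccontinuous_fourier_sum.
(* The weight that balances the two terms of the majorant: [e + e^-1 4^-j] is [2 * 2^-j], which is
   summable. *)
pose e j : R := 2^-1 ^+ j.
have e0 j : 0 < e j by rewrite exprn_gt0.
pose h j x := (e j + (e j)^-1 * normc (D j x) ^+ 2) / 2.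
have h0 j x : 0 <= h j x.
  have e0_le := ltW (e0 j).
  by rewrite /h divr_ge0// addr_ge0// mulr_ge0 ?invr_ge0 ?sqr_ge0.
have Dh j x : normc (D j x) <= h j x by exact: ler_young.
have mh j : measurable_fun period (fun x => (h j x)%:E).
  apply/measurable_EFinP; apply: measurable_funTS; apply: continuous_measurable_fun.
  move=> x; apply: cvgM; last exact: cvg_cst.
  apply: cvgD; first exact: cvg_cst.
  by apply: cvgM; [exact: cvg_cst|exact: ccontinuous_normc_sqr].
have ih j : (\int[mu]_(x in period) (h j x)%:E <= (2 * pi * 2^-1 ^+ j)%:E)%E.
  have := @integral_normc_majorant (D j) (e j) (4^-1 ^+ j) (e0 j) (cD j) _.
  rewrite (_ : pi * _ = 2 * pi * 2^-1 ^+ j); last first.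
    have -> : 4^-1 ^+ j = e j * e j by rewrite /e -exprMn -invfM -natrM.
    by rewrite mulrA mulVf ?gt_eqF// mul1r /e; ring.
  apply; rewrite DE integral_fourier_sum_sqr ler_pM2l ?pi2_gt0//.
  apply: le_trans (tail j); rewrite (@big_cat_nat _ _ _ (K j) 0)//= ?ndK//.
  rewrite [X in X + _]big_nat big1 ?add0r.
    by rewrite ler_sum_nat// => i /andP[Ki _]; rewrite /c' Ki.
  by move=> i /andP[_ iK]; rewrite /c' leqNgt iK (@Normc.normc0 R) expr0n.
pose H x : \bar R := (\sum_(0 <= j <oo) (h j x)%:E)%E.
have H0 x : (0 <= H x)%E by apply: nneseries_ge0 => j _ _; rewrite lee_fin.
have mH : measurable_fun period H.
  apply: (emeasurable_fun_cvg (fun n x => \sum_(0 <= j < n) (h j x)%:E)%E).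
    by move=> n; apply: emeasurable_sum => j.
  by move=> x _; apply: is_cvg_nneseries => j _ _; rewrite lee_fin.
have iH : mu.-integrable period H.
  apply/integrableP; split => //; under eq_integral do rewrite gee0_abs//.
  rewrite integral_nneseries//; last by move=> j x _; rewrite lee_fin.
  apply: le_lt_trans (nneseries_geometric_lty (ltW pi2_gt0)).
  apply: lee_nneseries => // j _ _.
  by apply: integral_ge0 => x _; rewrite lee_fin.
(* Majorant of all partial sums at once: [1 + |S 0|^2] bounds the first one, [H] the increments. *)
pose g x := ((1 + normc (S 0%N x) ^+ 2)%:E + H x)%E.
have ig : mu.-integrable period g.
  apply: integrableD => //; apply: continuous_integrable => x.
  by apply: cvgD; [exact: cvg_cst|exact: ccontinuous_normc_sqr].
have dom (u : R^nat) x : (forall j, `|u j.+1 - u j| <= normc (D j x)) ->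
    `|u 0%N| <= normc (S 0%N x) -> forall j, (`|u j|%:E <= g x)%E.
  move=> uD u0 j; rewrite /g.
  have := @ler_increments _ u (h ^~ x) j (fun i => le_trans (uD i) (Dh i x)).
  rewrite -lee_fin => /le_trans; apply; rewrite EFinD; apply: leeD.
    rewrite lee_fin; apply: (le_trans u0); apply: ler_sqr1; exact: normc_ge0.
  by rewrite -sumEFin; apply: nneseries_lim_ge => i _ _; rewrite lee_fin.
have cv (u : nat -> R -> R) : (forall j x, `|u j.+1 x - u j x| <= normc (D j x)) ->
    {ae mu, forall x, period x -> cvgn (u ^~ x)}.
  move=> uD.
  have : {ae mu, forall x, period x -> H x \is a fin_num} by apply: integrable_ae iH.
  apply: filterS; first exact: (ae_filter_ringOfSetsType mu).
  move=> x Hx px.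
  apply: (@cvgn_increments _ _ (h ^~ x)) => [j|].
    exact: le_trans (uD j x) (Dh j x).
  by have := Hx px; rewrite ge0_fin_numE.
have Re_inc j x : `|Re (S j.+1 x) - Re (S j x)| <= normc (D j x).
  by rewrite -cReB; exact: normc_Re.
have Im_inc j x : `|Im (S j.+1 x) - Im (S j x)| <= normc (D j x).
  by rewrite -cImB; exact: normc_Im.
have [U [iU aeU cvU]] := @dominated_limit _ _ _ mu period measurable_period
  (fun j x => Re (S j x)) g
  (fun j => measurable_funTS (continuous_measurable_fun (cS j).1)) ig
  (fun j x _ => dom _ x (fun i => Re_inc i x) (normc_Re _) j) (cv _ Re_inc).
have [V [iV aeV cvV]] := @dominated_limit _ _ _ mu period measurable_period
  (fun j x => Im (S j x)) g
  (fun j => measurable_funTS (continuous_measurable_fun (cS j).2)) ig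
  (fun j x _ => dom _ x (fun i => Im_inc i x) (normc_Im _) j) (cv _ Im_inc).
pose G x := U x +i* V x.
have iG : cintegrable period G by [].
have GV : fourier G =1 fourier v.
  move=> n; have [m <-] := zigzag_surj n.
  pose w x : R[i] := expi (- (zigzag m)%:~R * x).
  have cw : ccontinuous w by exact: ccontinuous_expi.
  have w1 x : `|Re (w x)| <= 1 /\ `|Im (w x)| <= 1.
    by split; [exact: cos_max|exact: sin_max].
  have mw1 : measurable_fun period (fun x => Re (w x)).
    exact: measurable_funTS (continuous_measurable_fun cw.1).
  have mw2 : measurable_fun period (fun x => Im (w x)).
    exact: measurable_funTS (continuous_measurable_fun cw.2).
  have fE f : fourier f (zigzag m) = ((2 * pi)^-1)%:C * cintegral period (fun x => w x * f x).
    by rewrite /fourier; congr (_ * cintegral _ _); apply/funext => x; rewrite /w mulNr.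
  (* As [K j >= j], the sum contains the index [m] from [j = m + 1] on. The sequence of its
     coefficients is eventually constant, which fixes the coefficient of the limit. *)
  have SE j : (m < j)%N -> cintegral period (fun x => w x * S j x) =
      (2 * pi)%:C * fourier v (zigzag m).
    move=> mj; have := fourier_fourier_sum c (K j) m.
    rewrite (leq_trans mj (Kge j)) fE -/(S j) -/(c m) => <-.
    by rewrite mulrA -realcM mulfV ?gt_eqF ?pi2_gt0// mul1r.
  suff -> : fourier G (zigzag m) = ((2 * pi)^-1)%:C * ((2 * pi)%:C * fourier v (zigzag m)).
    by rewrite mulrA -realcM mulVf ?gt_eqF ?pi2_gt0// mul1r.
  rewrite fE; congr (_ * _).
  have iS j : cintegrable period (S j) by exact: ccontinuous_integrable.
  have eventually_cst (z : R) (F : nat -> R) (l : R) :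
      (forall j, (m < j)%N -> F j = z) -> F @ \oo --> l -> l = z.
    move=> Fz Fl; apply: (cvg_unique (@Rhausdorff R) Fl).
    by apply: cvg_near_cst; exists m.+1 => // j /= mj; exact: Fz.
  apply: complex_ext.
    apply: (eventually_cst _ (fun j => Re (cintegral period (fun x => w x * S j x)))).
      by move=> j mj; rewrite SE.
    rewrite cintegralM_parts//.
    rewrite (_ : (fun j => Re (cintegral period (fun x => w x * S j x))) = fun j =>
        \int[mu]_(x in period) (Re (w x) * Re (S j x)) -
        \int[mu]_(x in period) (Im (w x) * Im (S j x))); last first.
      by apply/funext => j; rewrite cintegralM_parts.
    by apply: cvgB; [apply: cvU => // x; exact: (w1 x).1|apply: cvV => // x; exact: (w1 x).2].
  apply: (eventually_cst _ (fun j => Im (cintegral period (fun x => w x * S j x)))).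
    by move=> j mj; rewrite SE.
  rewrite cintegralM_parts//.
  rewrite (_ : (fun j => Im (cintegral period (fun x => w x * S j x))) = fun j =>
      \int[mu]_(x in period) (Re (w x) * Im (S j x)) +
      \int[mu]_(x in period) (Im (w x) * Re (S j x))); last first.
    by apply/funext => j; rewrite cintegralM_parts.
  by apply: cvgD; [apply: cvV => // x; exact: (w1 x).1|apply: cvU => // x; exact: (w1 x).2].
have := fourier_inj_ae iG iv GV.
move: aeU aeV; apply: filterS3.
move=> x Ux Vx Gx px; rewrite -(Gx px) /=; split; [exact: Ux|exact: Vx].
Qed.

End L2_convergence.


(** * The upper bound and the maximizing sequence *)

Section extended_real_lemmas.
Context {R : realType}.
Local Open Scope ereal_scope.
Implicit Types u : (\bar R)^nat.

Lemma limn_einf_le u c : (forall n, u n <= c) -> limn_einf u <= c.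
Proof.
move=> uc; rewrite limn_einf_lim; apply: lime_le; first exact: is_cvg_einfs.
apply: nearW => n; apply: le_trans (uc n); apply: ereal_inf_lbound.
by exists n => /=.
Qed.

Lemma limn_einf_ge u c : (forall n, c <= u n) -> c <= limn_einf u.
Proof.
move=> uc; rewrite limn_einf_lim; apply: lime_ge; first exact: is_cvg_einfs.
by apply: nearW => n; apply: le_ereal_inf_tmp => _ [k _ <-]; exact: uc.
Qed.

(* The library's ge0_le_integral asks for measurability; the chosen
   representatives of T_t u need not depend measurably on t. *)
Lemma ge0_le_integral_nonmeasurable d (T : measurableType d)
    (mu : {measure set T -> \bar R}) (D : set T) (f g : T -> \bar R) :
  (forall x, D x -> 0 <= f x) -> (forall x, D x -> f x <= g x) ->
  \int[mu]_(x in D) f x <= \int[mu]_(x in D) g x.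
Proof.
move=> f0 fg; have g0 x : D x -> 0 <= g x by move=> Dx; exact: le_trans (f0 _ Dx) (fg _ Dx).
rewrite !ge0_integralE//; apply: ereal_sup_le => _ [h hf <-]; exists h => // x.
apply: (le_trans (hf x)); rewrite !patchE; case: ifPn => // xD.
by apply: fg; exact/set_mem.
Qed.

(** The bound [m < K j] keeps a prescribed term in every partial sum; [W_lt] draws its strict
    inequality from it. *)
Lemma tail_subsequence (c : R^nat) (M : R) (m : nat) :
  (forall i, 0 <= c i)%R -> (forall n, \sum_(0 <= i < n) c i <= M)%R ->
  exists K : nat -> nat, [/\ {homo K : i j / (i <= j)%N},
    forall j, (j <= K j)%N, forall j, (m < K j)%N &
    forall j, (\sum_(K j <= i < K j.+1) c i <= 4^-1 ^+ j)%R].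
Proof.
move=> c0 cM; pose s n : R := (\sum_(0 <= i < n) c i)%R.
have nds : {homo s : i j / (i <= j)%N >-> (i <= j)%R}.
  move=> i j ij; rewrite /s (@big_cat_nat _ _ _ i 0 j)//= lerDl.
  exact: sumr_ge0.
have ubs : has_ubound (range s) by exists M => _ [n _ <-]; exact: cM.
have cs := nondecreasing_is_cvgn nds ubs.
have sl n : (s n <= limn s)%R by exact: nondecreasing_cvgn_le.
have /choice[k hk] : forall j, exists k, (limn s - 4^-1 ^+ j <= s k)%R.
  move=> j; have e0 : (0 < 4^-1 ^+ j :> R)%R by rewrite exprn_gt0.
  have /cvgrPdist_le/(_ _ e0)[k _ hk] := cs; exists k.
  by have := hk k (leqnn k); rewrite /= ger0_norm ?subr_ge0// => h; rewrite lerBlDr -lerBlDl.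
(* Summing the thresholds [k i] makes the sequence monotone and at least [k j]; the summand
   [j + m.+1] gives the other two lower bounds. *)
exists (fun j => (\sum_(0 <= i < j.+1) k i + (j + m.+1))%N).
have nd : {homo (fun j => (\sum_(0 <= i < j.+1) k i + (j + m.+1))%N) :
    i j / (i <= j)%N}.
  move=> i j ij; rewrite leq_add ?leq_add2r//.
  by rewrite [leqRHS](@big_cat_nat _ _ _ i.+1 0)//= leq_addr.
split => //= j.
- by rewrite addnCA leq_addr.
- by rewrite addnA addnS ltnS leq_addl.
set a := (_ + _)%N; set b := (_ + _)%N.
have ab : (a <= b)%N by exact: nd (leqnSn j).
have ka : (k j <= a)%N by rewrite /a big_nat_recr//= -addnA addnCA leq_addr.
have -> : (\sum_(a <= i < b) c i = s b - s a)%R.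
  by rewrite /s [in RHS](@big_cat_nat _ _ _ a 0 b)//= addrAC subrr add0r.
have := sl b; have := hk j; have := nds _ _ ka; lra.
Qed.

End extended_real_lemmas.

(** * The strict upper bound, and the values on flat trigonometric polynomials *)

Section main_estimates.
Context {R : realType}.
Let mu := @lebesgue_measure R.
Local Notation Re := complex.Re.
Local Notation Im := complex.Im.
Local Notation normc := Normc.normc.
Implicit Types (u v : R -> R[i]) (a : nat -> R[i]).

Lemma normc_pow4 (z : R[i]) : normc z ^+ 4 = (Re z ^+ 2 + Im z ^+ 2) ^+ 2.
Proof. by rewrite -normc_sqr; ring. Qed.

Lemma measurable_normc_pow4 v : cmeasurable v ->
  measurable_fun setT (fun x => normc (v x) ^+ 4).
Proof.
move=> mv; rewrite (_ : (fun x => _) = fun x => (normc (v x) ^+ 2) ^+ 2).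
  by apply: measurable_funX; exact: measurable_normc_sqr.
by apply/funext => x; ring.
Qed.

Lemma ccontinuous_cmeasurable v : ccontinuous v -> cmeasurable v.
Proof. by move=> [vr vi]; split; exact: continuous_measurable_fun. Qed.

Definition flow a (t : R) (n : nat) : R[i] :=
  expi (- ((zigzag n)%:~R ^+ 2 * t)) * a n.

Lemma normc_flow a t n : normc (flow a t n) = normc (a n).
Proof. by rewrite Normc.normcM normc_expi mul1r. Qed.

Definition partial_pow4 a K (t : R) :=
  \int[mu]_(x in period) normc (fourier_sum (flow a t) K x) ^+ 4.

Lemma partial_pow4E a K : partial_pow4 a K =
  wave_pow4 (fun i : 'I_K => a i) (fun i : 'I_K => zigzag i).
Proof. by apply/funext => t; rewrite /partial_pow4 fourier_sum_trigsum. Qed.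

Lemma integral_partial_pow4_period a K t :
  (\int[mu]_(x in period) (normc (fourier_sum (flow a t) K x) ^+ 4)%:E)%E =
  (partial_pow4 a K t)%:E.
Proof.
rewrite /partial_pow4 /Rintegral fineK//; apply: integrable_fin_num.
  exact: measurable_period.
have /ccontinuous_normc_sqr c2 := ccontinuous_fourier_sum (flow a t) K.
apply: (@continuous_integrable _ _ _ (fun x => normc (fourier_sum (flow a t) K x) ^+ 4)).
rewrite (_ : (fun x => _) = fun x => (normc (fourier_sum (flow a t) K x) ^+ 2) *
  (normc (fourier_sum (flow a t) K x) ^+ 2)).
  by move=> x; apply: cvgM; exact: c2.
by apply/funext => x; ring.
Qed.

Lemma continuous_partial_pow4 a K : continuous (partial_pow4 a K).
Proof.
rewrite partial_pow4E; apply: continuous_wave_pow4.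
Qed.

Lemma partial_pow4_ge0 a K t : 0 <= partial_pow4 a K t.
Proof. by apply: Rintegral_ge0 => x _; rewrite exprn_ge0// normc_ge0. Qed.

Lemma integral_partial_pow4 a K (N : nat) : (0 < N)%N ->
  (\int[mu]_(t in `[0%R, (N%:R * pi)%R]) (partial_pow4 a K t)%:E)%E =
  (N%:R * (2 * pi ^+ 2) * (2 * (\sum_(0 <= i < K) normc (a i) ^+ 2) ^+ 2 -
    \sum_(0 <= i < K) normc (a i) ^+ 4))%:E.
Proof.
move=> N0; rewrite -[LHS]fineK; last first.
  apply: integrable_fin_num => //.
  by apply: (@continuous_integrable _ _ _ (partial_pow4 a K)); exact: continuous_partial_pow4.
congr (_%:E); rewrite -[LHS]/(\int[mu]_(t in `[0, N%:R * pi]) partial_pow4 a K t).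
rewrite partial_pow4E integral_wave_pow4//; last first.
  by move=> i j /zigzag_inj ij; exact: val_inj.
by rewrite /mass !big_mkord.
Qed.

Lemma schrodinger_pow4_le u (K : nat -> nat) t : L2T u ->
  {homo K : i j / (i <= j)%N} -> (forall j, (j <= K j)%N) ->
  (forall j, \sum_(K j <= i < K j.+1) normc (fourier u (zigzag i)) ^+ 2 <=
    4^-1 ^+ j) ->
  (\int[mu]_(x in period) (normc (schrodinger t u x) ^+ 4)%:E <=
   limn_einf (fun j => (partial_pow4 (fun i => fourier u (zigzag i)) (K j) t)%:E))%E.
Proof.
move=> L2u ndK Kge tail; pose a i := fourier u (zigzag i).
(* If the default 0 were taken, the left side would be 0 and the bound immediate; so existence of
   the evolved function is not at issue. *)
rewrite /schrodinger; case: xgetP => [v _ [L2v vE]|_]; last first.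
  rewrite integral0_eq; last first.
    by move=> x _; rewrite (@Normc.normc0 R) expr0n.
  by apply: limn_einf_ge => n; rewrite lee_fin partial_pow4_ge0.
have aE i : fourier v (zigzag i) = flow a t i by rewrite vE.
have tailv j : \sum_(K j <= i < K j.+1) normc (fourier v (zigzag i)) ^+ 2 <= 4^-1 ^+ j.
  by apply: le_trans (tail j); apply: ler_sum => i _; rewrite aE normc_flow.
have := ae_cvg_fourier_sum (L2T_cintegrable L2v) ndK Kge tailv.
rewrite (_ : (fun i => fourier v (zigzag i)) = flow a t); last exact/funext.
move=> cv; pose f j x := (normc (fourier_sum (flow a t) (K j) x) ^+ 4)%:E.
have mf j : measurable_fun period (f j).
  apply/measurable_EFinP; apply: measurable_funTS; apply: measurable_normc_pow4.
  by apply: ccontinuous_cmeasurable; exact: ccontinuous_fourier_sum.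
have f0 j x : (0 <= f j x)%E by rewrite lee_fin exprn_ge0// normc_ge0.
have [mv _ _] := L2v.
apply: (@le_trans _ _ (\int[mu]_(x in period) limn_einf (f ^~ x))%E).
  rewrite le_eqVlt; apply/orP; left; apply/eqP.
  apply: ge0_ae_eq_integral => //.
  - by apply/measurable_EFinP; apply: measurable_funTS; exact: measurable_normc_pow4.
  - rewrite /limn_einf; apply: measurableT_comp => //.
    apply: (@measurable_fun_limn_esup _ _ _ _ (fun j x => - f j x)%E) => n.
    by apply: measurableT_comp => //; exact: mf.
  - by move=> x _; rewrite lee_fin exprn_ge0// normc_ge0.
  - by move=> x _; exact: limn_einf_ge.
  move: cv; apply: filterS; first exact: (ae_filter_ringOfSetsType mu).
  move=> x h px; have [hr hi] := h px.
  (* Where the sums converge, the lower limit in Fatou's lemma is the fourth power of the evolved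
     function. *)
  have : f j x @[j --> \oo] --> (normc (v x) ^+ 4)%:E.
    apply/fine_cvgP; split; first exact: nearW.
    rewrite normc_pow4 /comp/f/=; under eq_fun do rewrite normc_pow4.
    rewrite expr2; under eq_fun do rewrite expr2.
    have c2 : (Re (fourier_sum (flow a t) (K n) x) ^+ 2 +
        Im (fourier_sum (flow a t) (K n) x) ^+ 2) @[n --> \oo] -->
        Re (v x) ^+ 2 + Im (v x) ^+ 2.
      by apply: cvgD; [exact: (cvgM hr hr)|exact: (cvgM hi hi)].
    exact: (cvgM c2 c2).
  by move=> /cvg_limn_einf_sup[-> _].
apply: (@le_trans _ _ (limn_einf (fun j => \int[mu]_(x in period) f j x)%E)).
  by apply: fatou => // j x _; exact: f0.
rewrite le_eqVlt; apply/orP; left; apply/eqP; congr limn_einf.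
by apply/funext => j; rewrite /f integral_partial_pow4_period.
Qed.

Lemma W_lt u (N : nat) : (0 < N)%N -> L2T u -> L2norm u = 1 ->
  (W (N%:R * pi) u < N%:R%:E)%E.
Proof.
move=> N0 L2u u1; pose a i := fourier u (zigzag i).
have mass1 n : \sum_(0 <= i < n) normc (a i) ^+ 2 <= (2 * pi)^-1.
  apply: le_trans (bessel n L2u) _.
  move: u1; rewrite /L2norm => /(congr1 (fun y => y ^+ 2)).
  rewrite sqr_sqrtr ?expr1n; last by apply: Rintegral_ge0 => x _; exact: sqr_ge0.
  by move=> ->; rewrite mulr1.
(* Fatou's lemma, used in [x] within [schrodinger_pow4_le], is now used in [t]. The quartic sum is
   then reduced to its [m]-th term. *)
have Wle (m : nat) : (W (N%:R * pi) u <=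
    (N%:R * (1 - 2 * pi ^+ 2 * normc (a m) ^+ 4))%:E)%E.
  have [|K [ndK Kge Km tail]] := tail_subsequence m _ mass1.
    by move=> i; exact: sqr_ge0.
  apply: (@le_trans _ _ (\int[mu]_(t in `[0%R, (N%:R * pi)%R])
      limn_einf (fun j => (partial_pow4 a (K j) t)%:E))%E).
    apply: ge0_le_integral_nonmeasurable => t _.
      by apply: integral_ge0 => x _; rewrite lee_fin exprn_ge0// normc_ge0.
    exact: schrodinger_pow4_le.
  apply: (@le_trans _ _ (limn_einf (fun j =>
      \int[mu]_(t in `[0%R, (N%:R * pi)%R]) (partial_pow4 a (K j) t)%:E)%E)).
    apply: fatou => //.
      move=> j; apply/measurable_EFinP; apply: measurable_funTS.
      by apply: continuous_measurable_fun; exact: continuous_partial_pow4.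
    by move=> j t _; rewrite lee_fin partial_pow4_ge0.
  apply: limn_einf_le => j; rewrite integral_partial_pow4// lee_fin.
  rewrite -mulrA ler_wpM2l//.
  set S := \sum_(0 <= i < K j) normc (a i) ^+ 2.
  set Q := \sum_(0 <= i < K j) normc (a i) ^+ 4.
  have S0 : 0 <= S by apply: sumr_ge0 => i _; exact: sqr_ge0.
  have S2 : S ^+ 2 <= (2 * pi)^-1 ^+ 2.
    by rewrite ler_sqr ?nnegrE ?mass1// invr_ge0 ltW ?pi2_gt0.
  have Qm : normc (a m) ^+ 4 <= Q.
    rewrite /Q big_mkord (bigD1 (Ordinal (Km j)))//= lerDl.
    by apply: sumr_ge0 => i _; rewrite exprn_ge0// normc_ge0.
  have p0 : 0 < pi :> R := pi_gt0 R.
  have : 2 * pi ^+ 2 * (2 * S ^+ 2 - Q) <=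
      2 * pi ^+ 2 * (2 * (2 * pi)^-1 ^+ 2 - normc (a m) ^+ 4).
    by rewrite ler_pM2l ?mulr_gt0 ?exprn_gt0// lerB// ler_pM2l.
  move=> /le_trans; apply; rewrite mulrBr lerD2r le_eqVlt; apply/orP; left.
  apply/eqP; move: p0; generalize (pi : R) => q q0.
  by field; rewrite gt_eqF.
(* A nonzero coefficient makes the loss positive; if there is none, [u] vanishes almost everywhere,
   against [L2norm u = 1]. *)
have [[m am]|a0] := pselect (exists m, a m != 0).
  apply: (le_lt_trans (Wle m)); rewrite lte_fin.
  have am0 : 0 < normc (a m).
    rewrite lt_neqAle normc_ge0 andbT eq_sym.
    by apply: contra am => /eqP/Normc.eq0_normc ->.
  rewrite -[ltRHS]mulr1 ltr_pM2l ?ltr0n// gtrBl.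
  by rewrite mulr_gt0 ?exprn_gt0// mulr_gt0 ?exprn_gt0 ?pi_gt0.
have a0' n : fourier u n = 0.
  have [k <-] := zigzag_surj n; apply/eqP; rewrite -[_ == _]negbK; apply/negP => ak.
  by apply: a0; exists k.
have u0 : (\int[mu]_(x in period) (normc (u x) ^+ 2)%:E = \int[mu]_(x in period) 0)%E.
  have [mcu _ _] := L2u.
  apply: ge0_ae_eq_integral => //.
  - by apply/measurable_EFinP; apply: measurable_funTS; exact: measurable_normc_sqr.
  - by move=> x _; rewrite lee_fin sqr_ge0.
  have := fourier_eq0_ae (L2T_cintegrable L2u) a0'.
  apply: filterS; first exact: (ae_filter_ringOfSetsType mu).
  by move=> x h px; rewrite h// (@Normc.normc0 R) expr0n.
move: u1; rewrite /L2norm /Rintegral u0 integral0/= sqrtr0 => /eqP.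
by rewrite eq_sym oner_eq0.
Qed.

Lemma expi_periodic (n : int) (x : R) :
  expi (n%:~R * (x + 2 * pi)) = expi (n%:~R * x) :> R[i].
Proof. by rewrite mulrDr expiD expi_pi_mul2 mulr1. Qed.

Lemma L2T_fourier_sum a K : L2T (fourier_sum a K).
Proof.
have cS := ccontinuous_fourier_sum a K.
split; first exact: ccontinuous_cmeasurable.
  by move=> x; apply: eq_bigr => i _; rewrite expi_periodic.
have /integrableP[_] : mu.-integrable period
    (fun x => (normc (fourier_sum a K x) ^+ 2)%:E).
  by apply: continuous_integrable; exact: ccontinuous_normc_sqr.
apply: le_lt_trans; rewrite le_eqVlt; apply/orP; left; apply/eqP.
by apply: eq_integral => x _; rewrite gee0_abs// lee_fin sqr_ge0.
Qed.

(** Here an evolved function is explicit, so the choice does not fall back on its default, and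
    uniqueness identifies the chosen one almost everywhere. *)
Lemma schrodinger_fourier_sum a K t :
  L2T (schrodinger t (fourier_sum a K)) /\
  {ae mu, forall x, period x ->
    schrodinger t (fourier_sum a K) x = fourier_sum (flow a t) K x}.
Proof.
have evolved : L2T (fourier_sum (flow a t) K) /\ forall n : int,
    fourier (fourier_sum (flow a t) K) n =
    expi (- (n%:~R ^+ 2 * t)) * fourier (fourier_sum a K) n.
  split; first exact: L2T_fourier_sum.
  move=> n; have [m <-] := zigzag_surj n; rewrite !fourier_fourier_sum.
  by case: ifP => _; rewrite ?mulr0.
rewrite /schrodinger; case: xgetP => [v _ [L2v vE]|/(_ _ evolved)//].
split => //; apply: fourier_inj_ae; first exact: L2T_cintegrable.
  by apply: L2T_cintegrable; case: evolved.
by move=> n; rewrite vE evolved.2.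
Qed.

Lemma W_fourier_sum a K (N : nat) : (0 < N)%N ->
  W (N%:R * pi) (fourier_sum a K) =
  (N%:R * (2 * pi ^+ 2) * (2 * (\sum_(0 <= i < K) normc (a i) ^+ 2) ^+ 2 -
    \sum_(0 <= i < K) normc (a i) ^+ 4))%:E.
Proof.
move=> N0; rewrite -integral_partial_pow4// /W.
apply: eq_integral => t _; rewrite -integral_partial_pow4_period.
have [[ms _ _] aes] := schrodinger_fourier_sum a K t.
apply: ge0_ae_eq_integral => //.
- by apply/measurable_EFinP; apply: measurable_funTS; exact: measurable_normc_pow4.
- apply/measurable_EFinP; apply: measurable_funTS; apply: measurable_normc_pow4.
  by apply: ccontinuous_cmeasurable; exact: ccontinuous_fourier_sum.
- by move=> x _; rewrite lee_fin exprn_ge0// normc_ge0.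
- by move=> x _; rewrite lee_fin exprn_ge0// normc_ge0.
move: aes; apply: filterS; first exact: (ae_filter_ringOfSetsType mu).
by move=> x h px; rewrite h.
Qed.

(** For given mass and length, equal moduli minimise the sum of fourth powers. The value gives the
    [K] squares the total [1 / (2 pi)]. *)
Definition flat_coef (K : nat) (n : nat) : R[i] := (Num.sqrt (2 * pi * K%:R)^-1)%:C.

Lemma normc_flat_coef_sqr K n : normc (flat_coef K n) ^+ 2 = (2 * pi * K%:R)^-1.
Proof.
rewrite normc_sqr /flat_coef /= expr0n addr0 sqr_sqrtr// invr_ge0 mulr_ge0//.
exact: ltW pi2_gt0.
Qed.

Lemma L2norm_flat K : (0 < K)%N -> L2norm (fourier_sum (flat_coef K) K) = 1.
Proof.
move=> K0; rewrite /L2norm integral_fourier_sum_sqr.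
under eq_bigr do rewrite normc_flat_coef_sqr.
rewrite big_const_nat subn0 iter_addr_0 -[_ *+ K]mulr_natr.
have k0 : K%:R != 0 :> R by rewrite pnatr_eq0 -lt0n.
rewrite invfM mulrA mulrA divff ?gt_eqF ?pi2_gt0// mul1r mulVf//.
exact: sqrtr1.
Qed.

Lemma W_flat K (N : nat) : (0 < K)%N -> (0 < N)%N ->
  W (N%:R * pi) (fourier_sum (flat_coef K) K) = (N%:R * (1 - (2 * K%:R)^-1))%:E.
Proof.
move=> K0 N0; rewrite W_fourier_sum//.
have n4 n : normc (flat_coef K n) ^+ 4 = (2 * pi * K%:R)^-1 ^+ 2.
  by rewrite -(normc_flat_coef_sqr K n); ring.
under eq_bigr do rewrite normc_flat_coef_sqr.
under [X in _ - X]eq_bigr do rewrite n4.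
rewrite !big_const_nat subn0 !iter_addr_0 -[_ *+ K]mulr_natr -[X in _ - X]mulr_natr.
have p0 : pi != 0 :> R by rewrite gt_eqF// pi_gt0.
have k0 : K%:R != 0 :> R by rewrite pnatr_eq0 -lt0n.
congr (_%:E); move: p0; generalize (pi : R) => q q0.
by field; rewrite q0 k0.
Qed.

End main_estimates.

Theorem corollary5p3 (R : realType) (B : R) (N : nat) (hN : (1 <= N)%N)
    (hB : B = N%:R * pi) :
  J1 B = (N%:R)%:E /\
  ~ (exists u0 : R -> complex R, [/\ L2T u0, L2norm u0 = 1 & W B u0 = J1 B]).
Proof.
rewrite hB; have JN : J1 (N%:R * pi) = (N%:R : R)%:E.
  apply/eqP; rewrite eq_le; apply/andP; split.
    by apply: ge_ereal_sup => _ [u [L2u u1] <-]; apply: ltW; exact: W_lt.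
  (* The values on the flat sums of length [n.+1]; the shift excludes the empty sum, whose norm is
     0. *)
  have cv : (N%:R * (1 - (2 * n.+1%:R)^-1))%:E @[n --> \oo] --> (N%:R : R)%:E.
    apply/fine_cvgP; split; first exact: nearW.
    rewrite /comp /= -[X in _ --> X]mulr1; apply: cvgM; first exact: cvg_cst.
    rewrite -[X in _ --> X]subr0; apply: cvgB; first exact: cvg_cst.
    rewrite -(mulr0 2^-1); under eq_fun do rewrite invfM.
    by apply: cvgM; [exact: cvg_cst|exact: cvg_harmonic].
  rewrite -(cvg_lim _ cv)//; apply: lime_le; first by apply/cvg_ex; eexists; exact: cv.
  apply: nearW => n; rewrite -W_flat//; apply: ereal_sup_ubound.
  exists (fourier_sum (flat_coef n.+1) n.+1) => //; split.
    exact: L2T_fourier_sum.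
  exact: L2norm_flat.
split=> // -[u [L2u u1]]; rewrite JN => Wu.
by have := W_lt hN L2u u1; rewrite Wu ltxx.
Qed.
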